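(* Let $c$ be an NNF constraint and $Q$ a set of refinements (qualifiers). (1) If $\mathrm{sat}(c,Q)$ (i.e. it returns True), then $c$ is satisfiable. (2) If $c$ is acyclic, then $\mathrm{sat}(c,Q)$ if and only if $c$ is satisfiable.
   Context: **Constraints.** Refinements $r$ (forming a set $R$) are formulas drawn from a decidable refinement logic, e.g. the quantifier-free theory of linear arithmetic and uninterpreted functions. $K$ is the set of refinement variables; each $\kappa\in K$ stands for an unknown relation and has a list $\mathrm{args}(\kappa)=\bar x$ of typed parameters; it is always applied to as many variables as it has parameters. Predicates: $p ::= r\mid\kappa(\bar y)\mid p_1\wedge p_2$. NNF constraints: $c ::= p\mid c_1\wedge c_2\mid\forall x{:}b.\,p\Rightarrow c$, with $b$ a base type. $\mathrm{kvars}(c)$ is the set of refinement variables occurring in $c$; $\kappa\in c$ means $\kappa$ occurs in $c$. **Assignments and satisfaction.** An assignment $\sigma$ maps refinement variables to refinements; it is partial if its range is predicates (possibly containing refinement variables). Refinement variables outside its domain are left unchanged. $\sigma(\kappa(\bar y))=\sigma(\kappa)[\bar y/\bar x]$ with $\bar x=\mathrm{args}(\kappa)$, $\sigma(r)=r$, and $\sigma$ extends homomorphically to predicates and constraints. A constraint without refinement variables is well-formed under an environment $\Gamma$ of typed variables if: for a refinement $r$, $r$ has type bool under $\Gamma$ (unrefined typing); for $c_1\wedge c_2$, both conjuncts are well-formed under $\Gamma$; for $\forall x{:}b.\,r\Rightarrow c$, both $r$ and $c$ are well-formed under $\Gamma,x{:}b$. A constraint containing a refinement variable is not well-formed. $\sigma$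 satisfies $c$ if $\sigma(c)$ contains no refinement variable, is well-formed under the empty environment, and is logically valid; $\sigma$ satisfies a set of constraints if it satisfies each member. $c$ is satisfiable if some assignment satisfies it. **Dependencies.** $\mathrm{flatten}(\mathit{true})=\emptyset$; $\mathrm{flatten}(p)=\{p\}$ for other predicates; $\mathrm{flatten}(c\wedge c')=\mathrm{flatten}(c)\cup\mathrm{flatten}(c')$; $\mathrm{flatten}(\forall x{:}b.\,p\Rightarrow c)=\{\forall x{:}b.\,p\Rightarrow c'\mid c'\in\mathrm{flatten}(c)\}$. For a flat constraint $\forall x_1{:}b_1.\,p_1\Rightarrow\dots\Rightarrow\forall x_n{:}b_n.\,p_n\Rightarrow p$ the head is $p$ and the body is $\{p_1,\dots,p_n\}$. $\mathrm{dep}(c)$ is the set of pairs $(\kappa,\kappa')$ such that some member of $\mathrm{flatten}(c)$ has $\kappa$ in its body and $\kappa'$ in its head. $c$ is acyclic if the directed graph $\mathrm{dep}(c)$ has no cycle (self-loops count as cycles). A set $\hat K\subseteq K$ cuts $c$ if the graph obtained from $\mathrm{dep}(c)$ by removing all pairs with a component in $\hat K$ has no cycle. **Scope.** $\mathrm{scope}(\kappa,c_1\wedge c_2)$ is $\mathrm{scope}(\kappa,c_1)$ if $\kappa\in c_1,\kappa\notin c_2$, and $\mathrm{scope}(\kappa,c_2)$ if $\kappa\notin c_1,\kappa\in c_2$; $\mathrm{scope}(\kappa,\forall x{:}b.\,p\Rightarrow c')=\forall x{:}b.\,p\Rightarrow\mathrm{scope}(\kappa,c')$ if $\kappa\notin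 p$; in all other cases $\mathrm{scope}(\kappa,c)=c$. **Solutions.** $\mathrm{sol}(\kappa,c)$ is the following predicate (here also built with $\vee$ and $\exists$): $\mathrm{sol}(\kappa,c_1\wedge c_2)=\mathrm{sol}(\kappa,c_1)\vee\mathrm{sol}(\kappa,c_2)$; $\mathrm{sol}(\kappa,\forall x{:}b.\,p\Rightarrow c)=\exists x{:}b.\,(p\wedge\mathrm{sol}(\kappa,c))$; $\mathrm{sol}(\kappa,\kappa(\bar y))=\bigwedge_i x_i=y_i$ where $\bar x=\mathrm{args}(\kappa)$; $\mathrm{sol}(\kappa,p)=\mathit{false}$ for predicates $p$ not covered by the previous clauses. The strongest scoped solution is $\hat\sigma_{c,\kappa}=[\kappa\mapsto\lambda\bar x.\,\mathrm{sol}(\kappa,c'')]$, where $\bar x=\mathrm{args}(\kappa)$ and $\mathrm{scope}(\kappa,c)$ is $\forall x_1{:}b_1.\,p_1\Rightarrow\dots\Rightarrow\forall x_n{:}b_n.\,p_n\Rightarrow c''$ with $\kappa\notin p_i$ for all $i$. **Elimination.** $\mathrm{elim}_\sigma(c_1\wedge c_2)=\mathrm{elim}_\sigma(c_1)\wedge\mathrm{elim}_\sigma(c_2)$; $\mathrm{elim}_\sigma(\forall x{:}b.\,p\Rightarrow c)=\forall x{:}b.\,\sigma(p)\Rightarrow\mathrm{elim}_\sigma(c)$; $\mathrm{elim}_\sigma(\kappa(\bar y))=\mathit{true}$ if $\kappa\in\mathrm{dom}(\sigma)$; $\mathrm{elim}_\sigma(p)=p$ for predicates not covered by the previous clauses.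 $\mathrm{elim1}(\kappa,c)=\mathrm{elim}_{\hat\sigma_{c,\kappa}}(c)$. Finally $\mathrm{elim}([],c)=c$ and $\mathrm{elim}(\kappa:\bar\kappa,c)=\mathrm{elim}(\bar\kappa,\mathrm{elim1}(\kappa,c))$; a set of refinement variables is eliminated by listing its elements one after the other, with no particular order prescribed. **The procedure sat.** $\mathrm{sat}(c,Q)=\mathrm{solve}(\mathrm{flatten}(c'),Q)$, where $c'=\mathrm{elim}(K\setminus\hat K,c)$ and $\hat K$ is a set that cuts $c$, computed greedily by removing refinement variables one at a time from the dependency graph of $c$ until the graph is acyclic (so nothing is removed if $c$ is acyclic). $\mathrm{solve}(C,Q)$ is the predicate-abstraction procedure of liquid typing for finite sets $C$ of flat constraints: it searches for an assignment satisfying $C$ among those mapping refinement variables to conjunctions of predicates obtained from $Q$, and returns True or False. Its known properties are: if it returns True then $C$ is satisfiable; and if no refinement variable occurs in $C$, it reduces to checking the validity of the members of $C$.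
   Formalization: In (2), ''satisfiable implies sat'' is claimed only if no variable is eliminated before one with strictly longer scope prefix (false for some orders); c is well typed, with distinct bound variables and parameters; refinements are closed under ∨ and ∃; solve is True exactly when its search succeeds. *)

(* Defs.v *)
(* Horn constraints with refinement variables, their elimination by strongest
   scoped solutions, and the resulting satisfiability procedure. *)
From Stdlib Require List.
From mathcomp Require Import all_boot.

Set Implicit Arguments.
Unset Strict Implicit.
Unset Printing Implicit Defensive.

Definition var := nat.

Section Env.
Variable S : eqType.

Definition decl := (var * S)%type.

Fixpoint lookup (G : seq decl) (x : var) : option S :=
  if G is (y, s) :: G' then if x == y then Some s else lookup G' x else None.

(* In the environment G, the variables ys have the types declared in ds. *)
Definition fits (G : seq decl) (ds : seq decl) (ys : seq var) : bool :=
  [seq lookup G y | y <- ys] == [seq Some d.2 | d <- ds].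
End Env.

(* A decidable refinement logic.  Validity is truth in all models, which covers
   uninterpreted functions; the values of all base types live in one universe
   [value M], and [carrier M b] singles out the values of type b. *)
Record logic := Logic {
  base : eqType;
  formula : Type;
  fvars : formula -> seq var;
  typed : seq (decl base) -> formula -> bool;
  model : Type;
  value : model -> Type;
  carrier : forall M : model, base -> value M -> Prop;
  holds : forall M : model, (var -> value M) -> formula -> Prop;
  decide : seq (decl base) -> formula -> bool;
  typed_fvars : forall G r x, typed G r -> x \in fvars r -> lookup G x <> None;
  typed_ext : forall G G' r, {in fvars r, lookup G =1 lookup G'} ->
    typed G r = typed G' r;
  holds_ext : forall M (e e' : var -> value M) r, {in fvars r, e =1 e'} ->
    holds e r <-> holds e' r;
  decideP : forall G r, typed G r ->
    (decide G r <-> forall M (e : var -> value M),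
       (forall x b, lookup G x = Some b -> carrier b (e x)) -> holds e r)
}.

Section Syntax.
Variables (L : logic) (K : finType).

(* [PTrue], [PFalse] and [PEq] are the refinements true, false and x = y.
   [PSub ds ys p] is p[ys/ds], the simultaneous substitution of the variables ys
   for those declared in ds.  It is kept explicit because p may still contain
   refinement variables: their later instances must be able to refer by name
   to the existentially bound variables of p, so these cannot be renamed. *)
Inductive predicate : Type :=
  | PRef of formula L
  | PTrue
  | PFalse
  | PEq of var & var
  | PKv of K & seq var
  | PAnd of predicate & predicate
  | POr of predicate & predicate
  | PEx of var & base L & predicate
  | PSub of seq (decl (base L)) & seq var & predicate.

Inductive constr : Type :=
  | CHead of predicate
  | CAnd of constr & constr
  | CAll of var & base L & predicate & constr.

Fixpoint pkvars (p : predicate) : seq K :=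
  match p with
  | PKv k _ => [:: k]
  | PAnd p1 p2 | POr p1 p2 => pkvars p1 ++ pkvars p2
  | PEx _ _ p' | PSub _ _ p' => pkvars p'
  | _ => [::]
  end.

Fixpoint kvars (c : constr) : seq K :=
  match c with
  | CHead p => pkvars p
  | CAnd c1 c2 => kvars c1 ++ kvars c2
  | CAll _ _ p c' => pkvars p ++ kvars c'
  end.

(* Refinements are the predicates without refinement variables, hence closed
   under disjunction and existential quantification: strongest solutions, even
   over a quantifier-free logic, are built with these. *)
Definition refinement (p : predicate) : bool := nilp (pkvars p).

(* The grammar p ::= r | k(ys) | p /\ p of input constraints. *)
Fixpoint nnf_pred (p : predicate) : bool :=
  match p with
  | PAnd p1 p2 => nnf_pred p1 && nnf_pred p2
  | POr _ _ | PEx _ _ _ | PSub _ _ _ => false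
  | _ => true
  end.

Fixpoint nnf (c : constr) : bool :=
  match c with
  | CHead p => nnf_pred p
  | CAnd c1 c2 => nnf c1 && nnf c2
  | CAll _ _ p c' => nnf_pred p && nnf c'
  end.

Fixpoint binders (c : constr) : seq var :=
  match c with
  | CHead _ => [::]
  | CAnd c1 c2 => binders c1 ++ binders c2
  | CAll x _ _ c' => x :: binders c'
  end.

Definition conjunction (ps : seq predicate) : predicate := foldr PAnd PTrue ps.

Fixpoint cflatten (c : constr) : seq constr :=
  match c with
  | CHead PTrue => [::]
  | CHead p => [:: CHead p]
  | CAnd c1 c2 => cflatten c1 ++ cflatten c2
  | CAll x b p c' => [seq CAll x b p d | d <- cflatten c']
  end.

Fixpoint flat (c : constr) : bool :=
  match c with
  | CHead _ => true
  | CAnd _ _ => false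
  | CAll _ _ _ c' => flat c'
  end.

Fixpoint flat_body (c : constr) : seq predicate :=
  if c is CAll _ _ p c' then p :: flat_body c' else [::].

(* The value on conjunctions, which are not flat, is irrelevant. *)
Fixpoint flat_head (c : constr) : predicate :=
  match c with
  | CHead p => p
  | CAnd _ _ => PTrue
  | CAll _ _ _ c' => flat_head c'
  end.

Definition dep (c : constr) : rel K := fun k k' =>
  has (fun d => has (fun p => k \in pkvars p) (flat_body d) &&
                (k' \in pkvars (flat_head d)))
      (cflatten c).

Definition dep_without (c : constr) (X : {set K}) : rel K := fun k k' =>
  [&& k \notin X, k' \notin X & dep c k k'].

Definition has_cycle (e : rel K) : Prop := exists2 s : seq K, s != [::] & cycle e s.

Definition acyclic (c : constr) : Prop := ~ has_cycle (dep c).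

Definition cuts (X : {set K}) (c : constr) : Prop := ~ has_cycle (dep_without c X).

(* [removed c X]: X can be removed one variable at a time, each removal taking
   place only because a cycle was left. *)
Inductive removed (c : constr) : {set K} -> Prop :=
  | Removed0 : removed c set0
  | RemovedS X k : removed c X -> ~ cuts X c -> k \notin X -> removed c (k |: X).

Definition greedy_cut (c : constr) (X : {set K}) : Prop := removed c X /\ cuts X c.

(* In head position p1 /\ p2 is also a constraint c1 /\ c2.  The equations of
   [scope], [sol] and [elim_] for conjunctions come first and apply to it, whence
   the auxiliary functions on heads. *)
Fixpoint scope_head (k : K) (p : predicate) : predicate :=
  match p with
  | PAnd p1 p2 =>
      match k \in pkvars p1, k \in pkvars p2 with
      | true, false => scope_head k p1
      | false, true => scope_head k p2
      | _, _ => p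
      end
  | _ => p
  end.

Fixpoint scope (k : K) (c : constr) : constr :=
  match c with
  | CHead p => CHead (scope_head k p)
  | CAnd c1 c2 =>
      match k \in kvars c1, k \in kvars c2 with
      | true, false => scope k c1
      | false, true => scope k c2
      | _, _ => c
      end
  | CAll x b p c' => if k \in pkvars p then c else CAll x b p (scope k c')
  end.

(* The binders x1 ... xn and the matrix c'' of a constraint
   forall x1. p1 => ... => forall xn. pn => c'', for the longest prefix such that
   k occurs in none of the pi. *)
Fixpoint prefix_vars (k : K) (c : constr) : seq var :=
  match c with
  | CAll x _ p c' => if k \in pkvars p then [::] else x :: prefix_vars k c'
  | _ => [::]
  end.

Fixpoint matrix (k : K) (c : constr) : constr :=
  match c with
  | CAll _ _ p c' => if k \in pkvars p then c else matrix k c'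
  | _ => c
  end.

(* The scope of k' lies strictly inside that of k. *)
Definition strictly_inside (c : constr) (k' k : K) : bool :=
  let xs := prefix_vars k (scope k c) in
  let xs' := prefix_vars k' (scope k' c) in
  prefix xs xs' && (xs != xs').

(* No variable of ks comes before one whose scope lies strictly inside its own.
   In other orders, strongest solutions may copy occurrences of a local variable
   out of its scope; the scope computed for it afterwards is wider, and its
   strongest scoped solution can then be too weak. *)
Definition local_first (c : constr) (ks : seq K) : Prop :=
  pairwise (fun k k' => ~~ strictly_inside c k' k) ks.

(* Possibly partial: [None] outside the domain. *)
Definition assignment := K -> option predicate.

Section Args.
Variable args : K -> seq (decl (base L)).

Fixpoint inst (s : assignment) (p : predicate) : predicate :=
  match p with
  | PKv k ys => if s k is Some q then PSub (args k) ys q else p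
  | PAnd p1 p2 => PAnd (inst s p1) (inst s p2)
  | POr p1 p2 => POr (inst s p1) (inst s p2)
  | PEx x b p' => PEx x b (inst s p')
  | PSub ds ys p' => PSub ds ys (inst s p')
  | _ => p
  end.

Fixpoint cinst (s : assignment) (c : constr) : constr :=
  match c with
  | CHead p => CHead (inst s p)
  | CAnd c1 c2 => CAnd (cinst s c1) (cinst s c2)
  | CAll x b p c' => CAll x b (inst s p) (cinst s c')
  end.

(* Typing in the presence of refinement variables: these must be applied to
   variables of the types of their parameters. *)
Fixpoint well_typed_pred (G : seq (decl (base L))) (p : predicate) : bool :=
  match p with
  | PRef r => typed G r
  | PTrue | PFalse => true
  | PEq x y => (lookup G x != None) && (lookup G x == lookup G y)
  | PKv k ys => fits G (args k) ys
  | PAnd p1 p2 | POr p1 p2 => well_typed_pred G p1 && well_typed_pred G p2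
  | PEx x b p' => well_typed_pred ((x, b) :: G) p'
  | PSub ds ys p' => fits G ds ys && well_typed_pred (ds ++ G) p'
  end.

Fixpoint well_typed (G : seq (decl (base L))) (c : constr) : bool :=
  match c with
  | CHead p => well_typed_pred G p
  | CAnd c1 c2 => well_typed G c1 && well_typed G c2
  | CAll x b p c' =>
      well_typed_pred ((x, b) :: G) p && well_typed ((x, b) :: G) c'
  end.

Definition well_formed (G : seq (decl (base L))) (c : constr) : bool :=
  nilp (kvars c) && well_typed G c.

Section Semantics.
Variable M : model L.

Definition update (e : var -> value M) (x : var) (v : value M) : var -> value M :=
  fun y => if y == x then v else e y.

Definition update_seq (e : var -> value M) (ds : seq (decl (base L)))
    (vs : seq (value M)) : var -> value M :=
  foldr (fun dv e' => update e' dv.1.1 dv.2) e (zip ds vs).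

(* The value at [PKv] is irrelevant: only constraints without refinement
   variables are ever interpreted. *)
Fixpoint peval (e : var -> value M) (p : predicate) : Prop :=
  match p with
  | PRef r => holds e r
  | PTrue => True
  | PFalse => False
  | PEq x y => e x = e y
  | PKv _ _ => False
  | PAnd p1 p2 => peval e p1 /\ peval e p2
  | POr p1 p2 => peval e p1 \/ peval e p2
  | PEx x b p' => exists v, carrier b v /\ peval (update e x v) p'
  | PSub ds ys p' => peval (update_seq e ds [seq e y | y <- ys]) p'
  end.

Fixpoint ceval (e : var -> value M) (c : constr) : Prop :=
  match c with
  | CHead p => peval e p
  | CAnd c1 c2 => ceval e c1 /\ ceval e c2
  | CAll x b p c' => forall v, carrier b v ->
      peval (update e x v) p -> ceval (update e x v) c'
  end.
End Semantics.

Definition valid (c : constr) : Prop :=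
  forall (M : model L) (e : var -> value M), ceval e c.

Definition satisfies (s : assignment) (c : constr) : Prop :=
  [/\ forall k p, s k = Some p -> refinement p,
      well_formed [::] (cinst s c) & valid (cinst s c)].

Definition satisfiable (c : constr) : Prop := exists s, satisfies s c.

Fixpoint sol_head (k : K) (p : predicate) : predicate :=
  match p with
  | PAnd p1 p2 => POr (sol_head k p1) (sol_head k p2)
  | PKv k' ys =>
      if k' == k then conjunction [seq PEq dy.1.1 dy.2 | dy <- zip (args k) ys]
      else PFalse
  | _ => PFalse
  end.

Fixpoint sol (k : K) (c : constr) : predicate :=
  match c with
  | CHead p => sol_head k p
  | CAnd c1 c2 => POr (sol k c1) (sol k c2)
  | CAll x b p c' => PEx x b (PAnd p (sol k c'))
  end.

Definition strongest (c : constr) (k : K) : assignment := fun k' =>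
  if k' == k then Some (sol k (matrix k (scope k c))) else None.

Fixpoint elim_head (s : assignment) (p : predicate) : predicate :=
  match p with
  | PAnd p1 p2 => PAnd (elim_head s p1) (elim_head s p2)
  | PKv k _ => if s k is Some _ then PTrue else p
  | _ => p
  end.

Fixpoint elim_ (s : assignment) (c : constr) : constr :=
  match c with
  | CHead p => CHead (elim_head s p)
  | CAnd c1 c2 => CAnd (elim_ s c1) (elim_ s c2)
  | CAll x b p c' => CAll x b (inst s p) (elim_ s c')
  end.

Definition elim1 (k : K) (c : constr) : constr := elim_ (strongest c k) c.

Fixpoint elim (ks : seq K) (c : constr) : constr :=
  if ks is k :: ks' then elim ks' (elim1 k c) else c.

(* ks lists the complement of a greedily computed cut set; any order is allowed. *)
Definition elim_list (c : constr) (ks : seq K) : Prop :=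
  exists X : {set K}, [/\ greedy_cut c X, uniq ks & ks =i ~: X].

(* Predicate abstraction: each refinement variable is mapped to a (possibly
   empty) conjunction of qualifiers whose variables have been instantiated so
   that the result is a predicate on the parameters of that variable. *)
Definition qualifier_instance (Q : seq predicate) (k : K) (p : predicate) : Prop :=
  exists q ds ys, [/\ List.In q Q, p = PSub ds ys q, refinement p
                    & well_typed_pred (args k) p].

Definition qualifier_assignment (Q : seq predicate) (s : assignment) : Prop :=
  forall k, exists ps, s k = Some (conjunction ps) /\
    forall p, List.In p ps -> qualifier_instance Q k p.

Definition is_solve (solve : seq constr -> seq predicate -> bool) : Prop :=
  forall C Q, all flat C -> all refinement Q ->
    (solve C Q <-> exists s, qualifier_assignment Q s /\
                     forall c, List.In c C -> satisfies s c).

(* The run of the procedure that eliminates the variables in the order ks. *)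
Definition sat (solve : seq constr -> seq predicate -> bool) (ks : seq K)
    (c : constr) (Q : seq predicate) : bool :=
  solve (cflatten (elim ks c)) Q.

End Args.
End Syntax.

(* Main.v *)
(* A variable is interpreted, in the style of dynamic scoping, by a relation on
   whole environments; then instantiation is composition of interpretations, and
   capture in copied solutions is not only harmless but meant.

   Soundness.  If rho makes elim1 k c true, then c is true once k is reinterpreted
   by its strongest solution under rho: each head k ys is reached along a path whose
   guards witness the solution.  This requires that these guards do not depend on k,
   which follows from a rank on the variables outside the cut set.

   Completeness.  Pulling the constantly true assignment back through the elimination
   yields an interpretation R of all variables such that R k is the strongest solution
   of k in the original constraint, under R itself; here the order of elimination is
   used, which keeps the scope of each variable unchanged until its turn.  By
   induction on the rank, R lies below every solution where the guards of the scope
   hold.  So if c is satisfiable its heads without variables hold under R, and these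
   are all that is left of the heads after elimination. *)
From Stdlib Require Import FunctionalExtensionality PropExtensionality.
Require Import Defs.
From mathcomp Require Import all_boot.

Set Implicit Arguments.
Unset Strict Implicit.
Unset Printing Implicit Defensive.

(** * Typing environments *)

Section Environments.
Variable S : eqType.
Implicit Types (G D : seq (decl S)).

Definition subenv G G' := forall x s, lookup G x = Some s -> lookup G' x = Some s.

Lemma subenv_refl G : subenv G G.
Proof. by []. Qed.
#[local] Hint Resolve subenv_refl : core.

Lemma lookup_cat G G' x :
  lookup (G ++ G') x = if lookup G x is Some s then Some s else lookup G' x.
Proof. by elim: G => [|[y s] G IH] //=; case: eqP. Qed.

Lemma lookup_notin G x : (x \notin map fst G) = (lookup G x == None).
Proof. by elim: G => [|[y s] G IH] //=; rewrite inE negb_or IH; case: eqP. Qed.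

Lemma lookup_mem G d : uniq (map fst G) -> d \in G -> lookup G d.1 = Some d.2.
Proof.
elim: G => [|[y s] G IH] //= /andP[yG uG]; rewrite inE => /orP[/eqP->|dG] /=.
  by rewrite eqxx.
by case: eqP => [e|_]; [rewrite -e map_f in yG|exact: IH].
Qed.

Lemma subenv_cons d G G' : subenv G G' -> subenv (d :: G) (d :: G').
Proof. by case: d => y t sG x s /=; case: eqP => // _; apply: sG. Qed.

Lemma subenv_cat D G G' : subenv G G' -> subenv (D ++ G) (D ++ G').
Proof. by move=> sG; elim: D => //= d D IH; apply: subenv_cons. Qed.

(* A variable cannot be rebound at another type as long as all types come from
   one environment T. *)
Lemma subenv_push T G G' x b :
  subenv G T -> lookup T x = Some b -> subenv G G' -> subenv G ((x, b) :: G').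
Proof.
move=> sT Tx sG y s Gy /=; case: eqP => [e|_]; last exact: sG.
by rewrite -Tx -e; apply: sT.
Qed.

Lemma subenv_cons_l T G x b :
  subenv G T -> lookup T x = Some b -> subenv ((x, b) :: G) T.
Proof. by move=> sT Tx y s /=; case: eqP => [-> [<-]|_] //; apply: sT. Qed.

Lemma fits_cons G d D y ys :
  fits G (d :: D) (y :: ys) = (lookup G y == Some d.2) && fits G D ys.
Proof. by rewrite /fits /= eqseq_cons. Qed.

Lemma fits_subenv G G' D ys : subenv G G' -> fits G D ys -> fits G' D ys.
Proof.
move=> sG; elim: D ys => [|d D IH] [|y ys] //; rewrite !fits_cons.
by case/andP=> /eqP/sG-> /IH->; rewrite eqxx.
Qed.

Lemma fits_size G D ys : fits G D ys -> size ys = size D.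
Proof. by move/eqP/(congr1 size); rewrite !size_map. Qed.

Lemma fits_lookup G D ys y : fits G D ys -> y \in ys -> lookup G y != None.
Proof.
elim: D ys => [|d D IH] [|z ys] //; rewrite fits_cons => /andP[/eqP Gz fD].
by rewrite inE => /orP[/eqP->|]; [rewrite Gz|apply: IH].
Qed.
End Environments.
#[local] Hint Resolve subenv_refl : core.

(** * Instantiation, elimination and their typing *)

Section Elimination.
Variables (L : logic) (K : finType) (args : K -> seq (decl (base L))).
Notation tenv := (seq (decl (base L))).
Implicit Types (G T : tenv) (p q : predicate L K) (c d : constr L K).
Implicit Types (s : assignment L K) (k : K).

Fixpoint heads c : seq K :=
  match c with
  | CHead p => pkvars p
  | CAnd c1 c2 => heads c1 ++ heads c2
  | CAll _ _ _ c' => heads c'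
  end.

Lemma heads_kvars k c : k \in heads c -> k \in kvars c.
Proof.
elim: c => [p|c1 IH1 c2 IH2|x b p c IH] //=; rewrite !mem_cat.
  by case/orP=> [/IH1->|/IH2->]; rewrite ?orbT.
by move=> /IH->; rewrite orbT.
Qed.

Definition scoped_sol k c := sol args k (matrix k (scope k c)).

Lemma scoped_sol_all k x b p c :
  scoped_sol k (CAll x b p c) =
  if k \in pkvars p then sol args k (CAll x b p c) else scoped_sol k c.
Proof. by rewrite /scoped_sol /=; case: ifP => kp /=; rewrite kp. Qed.

Lemma scoped_sol_and k c1 c2 :
  scoped_sol k (CAnd c1 c2) =
  match k \in kvars c1, k \in kvars c2 with
  | true, false => scoped_sol k c1
  | false, true => scoped_sol k c2
  | _, _ => sol args k (CAnd c1 c2)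
  end.
Proof. by rewrite /scoped_sol /=; do 2!case: ifP. Qed.

Definition scope_vars k c := prefix_vars k (scope k c).

Lemma scope_vars_all k x b p c :
  scope_vars k (CAll x b p c) = if k \in pkvars p then [::] else x :: scope_vars k c.
Proof. by rewrite /scope_vars /=; case: ifP => kp /=; rewrite kp. Qed.

Lemma scope_vars_and k c1 c2 :
  scope_vars k (CAnd c1 c2) =
  match k \in kvars c1, k \in kvars c2 with
  | true, false => scope_vars k c1
  | false, true => scope_vars k c2
  | _, _ => [::]
  end.
Proof. by rewrite /scope_vars /=; do 2!case: ifP. Qed.

(** By conversion, [strongest args c k] is [single k (scoped_sol k c)]; single elimination steps are
    mostly studied for an arbitrary [q] in its place. *)
Definition single k q : assignment L K := fun k' => if k' == k then Some q else None.

Definition compose s1 s2 : assignment L K :=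
  fun k => if s2 k is Some q then Some (inst args s1 q) else s1 k.

Lemma inst_compose s1 s2 p :
  inst args (compose s1 s2) p = inst args s1 (inst args s2 p).
Proof.
elim: p => //= [k ys|p1 -> p2 -> | p1 -> p2 -> |x b p ->|D ys p ->] //.
by rewrite /compose; case: (s2 k).
Qed.

Lemma inst_None p : inst args (fun _ => None) p = p.
Proof. by elim: p => //= [p1 -> p2 -> | p1 -> p2 -> |x b p ->|D ys p ->]. Qed.

Lemma eq_inst s1 s2 p : {in pkvars p, s1 =1 s2} -> inst args s1 p = inst args s2 p.
Proof.
elim: p => //= [k ys|p1 IH1 p2 IH2|p1 IH1 p2 IH2|x b p IH|D ys p IH] e.
- by rewrite e ?inE.
- by rewrite IH1 ?IH2 // => k kp; apply: e; rewrite mem_cat kp ?orbT.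
- by rewrite IH1 ?IH2 // => k kp; apply: e; rewrite mem_cat kp ?orbT.
- by rewrite IH.
- by rewrite IH.
Qed.

Lemma inst_single_id k q p : k \notin pkvars p -> inst args (single k q) p = p.
Proof.
move=> kp; rewrite -[RHS]inst_None; apply: eq_inst => k' k'p.
by rewrite /single; case: eqP => // e; rewrite -e k'p in kp.
Qed.

Lemma elim_head_id k q p : k \notin pkvars p -> elim_head (single k q) p = p.
Proof.
elim: p => //= [k' ys|p1 IH1 p2 IH2]; rewrite ?inE ?mem_cat.
  by rewrite /single eq_sym; case: eqP.
by rewrite negb_or => /andP[/IH1-> /IH2->].
Qed.

Lemma elim_id k q c : k \notin kvars c -> elim_ args (single k q) c = c.
Proof.
elim: c => [p|c1 IH1 c2 IH2|x b p c IH] /=; rewrite ?mem_cat ?negb_or.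
- by move/elim_head_id->.
- by case/andP=> /IH1-> /IH2->.
- by case/andP=> /inst_single_id-> /IH->.
Qed.

Lemma well_typed_subenv G G' p :
  subenv G G' -> well_typed_pred args G p -> well_typed_pred args G' p.
Proof.
elim: p G G' => //= [r|x y|k ys|p1 IH1 p2 IH2|p1 IH1 p2 IH2|x b p IH|D ys p IH]
  G G' sG.
- move=> Gr; rewrite -(@typed_ext L G) // => x xr.
  case Gx: (lookup G x) => [t|]; first by rewrite (sG _ _ Gx).
  by case: (typed_fvars Gr xr).
- case Gx: (lookup G x) => [t|] //= /eqP/esym Gy.
  by rewrite (sG _ _ Gx) (sG _ _ Gy) eqxx.
- exact: fits_subenv.
- by case/andP=> /(IH1 _ _ sG)-> /(IH2 _ _ sG)->.
- by case/andP=> /(IH1 _ _ sG)-> /(IH2 _ _ sG)->.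
- exact/IH/subenv_cons.
- case/andP=> /(fits_subenv sG)-> /=; exact/IH/subenv_cat.
Qed.

(* The binders occurring in predicates are copies of those of the original
   constraint, whose types are listed in T, and formal parameters never clash
   with them.  This is what makes capture harmless. *)
Fixpoint clean_pred T p : Prop :=
  match p with
  | PAnd p1 p2 | POr p1 p2 => clean_pred T p1 /\ clean_pred T p2
  | PEx x b p' => lookup T x = Some b /\ clean_pred T p'
  | PSub ds _ p' => {in map fst ds, forall x, lookup T x = None} /\ clean_pred T p'
  | _ => True
  end.

Fixpoint clean T c : Prop :=
  match c with
  | CHead p => nnf_pred p
  | CAnd c1 c2 => clean T c1 /\ clean T c2
  | CAll x b p c' => [/\ lookup T x = Some b, clean_pred T p & clean T c']
  end.

Definition params_apart T := forall k, {in map fst (args k), forall x, lookup T x = None}.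

Lemma subenv_cat_fresh T G G' D :
  subenv G T -> {in map fst D, forall x, lookup T x = None} ->
  subenv G G' -> subenv G (D ++ G').
Proof.
move=> sT DT sG x t Gx; rewrite lookup_cat.
case Dx: (lookup D x) => [u|]; last exact: sG.
have /DT : x \in map fst D by apply: contraT; rewrite lookup_notin Dx.
by rewrite (sT _ _ Gx).
Qed.

(** A copy of [q] is typed wherever it lands: binders of [p] rebind a variable of [G0] only at its
    type in [T], and formal parameters of substitutions are absent from [T], so the local
    environment keeps extending [G0]. *)
Lemma inst_typed T G0 k q G p :
  subenv G0 T -> subenv G0 G -> clean_pred T p ->
  well_typed_pred args (args k ++ G0) q -> well_typed_pred args G p ->
  well_typed_pred args G (inst args (single k q) p).
Proof.
move=> sT + + qT.
elim: p G => //= [k' ys|p1 IH1 p2 IH2|p1 IH1 p2 IH2|x b p IH|D ys p IH] G sG.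
- rewrite /single; case: eqP => //= -> _ ->; apply: well_typed_subenv qT.
  exact: subenv_cat.
- by case=> [c1 c2] /andP[/IH1-> // /IH2->].
- by case=> [c1 c2] /andP[/IH1-> // /IH2->].
- by case=> Tx cp; apply: IH => //; apply: subenv_push Tx sG.
- by case=> DT cp /andP[-> /=]; apply: IH => //; apply: subenv_cat_fresh DT sG.
Qed.

Lemma inst_clean T s p :
  params_apart T -> clean_pred T p ->
  (forall k q, s k = Some q -> clean_pred T q) -> clean_pred T (inst args s p).
Proof.
move=> pT + sT; elim: p => //= [k ys|p1 IH1 p2 IH2|p1 IH1 p2 IH2|x b p IH|D ys p IH].
- by case sk: (s k) => [q|] //= _; split; [exact: pT|exact: sT sk].
- by case=> /IH1 ? /IH2.
- by case=> /IH1 ? /IH2.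
- by case=> ? /IH.
- by case=> ? /IH.
Qed.

Lemma elim_head_nnf s p : nnf_pred p -> nnf_pred (elim_head s p).
Proof.
elim: p => //= [k ys|p1 IH1 p2 IH2]; first by case: (s k).
by case/andP=> /IH1-> /IH2->.
Qed.

Lemma elim_clean T s c :
  params_apart T -> clean T c ->
  (forall k q, s k = Some q -> clean_pred T q) -> clean T (elim_ args s c).
Proof.
move=> pT + sT; elim: c => [p|c1 IH1 c2 IH2|x b p c IH] /=.
- exact: elim_head_nnf.
- by case=> /IH1 ? /IH2.
- by case=> Tx cp /IH ?; split=> //; apply: inst_clean.
Qed.

Lemma sol_clean T k c : clean T c -> clean_pred T (sol args k c).
Proof.
elim: c => [p _|c1 IH1 c2 IH2|x b p c IH] /=.
- elim: p => //= k' ys; case: eqP => // _; elim: (zip _ _) => //=.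
- by case=> /IH1 ? /IH2.
- by case=> ? ? /IH.
Qed.

Lemma scoped_sol_clean T k c : clean T c -> clean_pred T (scoped_sol k c).
Proof.
elim: c => [p|c1 IH1 c2 IH2|x b p c IH] cc.
- have cp' p' : clean_pred T (sol args k (CHead p')).
    elim: p' => //= k' ys; case: eqP => // _; elim: (zip _ _) => //=.
  exact: (cp' (scope_head k p)).
- have [c1c c2c] := cc; rewrite scoped_sol_and.
  by do 2!case: ifP => _; [exact: sol_clean|exact: IH1|exact: IH2|exact: sol_clean].
- rewrite scoped_sol_all; case: ifP => _; first exact: sol_clean.
  by case: cc => _ _; apply: IH.
Qed.

(** The environment reached where the prefix of the scope of [k] ends; together with the parameters
    of [k] it types the strongest scoped solution. *)
Fixpoint scope_env G k c : tenv :=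
  match c with
  | CHead _ => G
  | CAnd c1 c2 =>
      match k \in kvars c1, k \in kvars c2 with
      | true, false => scope_env G k c1
      | false, true => scope_env G k c2
      | _, _ => G
      end
  | CAll x b p c' => if k \in pkvars p then G else scope_env ((x, b) :: G) k c'
  end.

Lemma scope_env_sub T G k c :
  subenv G T -> clean T c -> subenv (scope_env G k c) T.
Proof.
elim: c G => [p|c1 IH1 c2 IH2|x b p c IH] G sT //=.
- by case=> ? ?; do 2!case: ifP => _ //; [apply: IH1|apply: IH2].
- by case=> Tx _ cc; case: ifP => // _; apply: IH => //; apply: subenv_cons_l.
Qed.

Fixpoint occurs_under k G0 G c : Prop :=
  match c with
  | CHead p => k \in pkvars p -> subenv G0 G
  | CAnd c1 c2 => occurs_under k G0 G c1 /\ occurs_under k G0 G c2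
  | CAll x b p c' =>
      (k \in pkvars p -> subenv G0 ((x, b) :: G)) /\ occurs_under k G0 ((x, b) :: G) c'
  end.

Lemma occurs_under_sub T k G0 G c :
  subenv G0 T -> clean T c -> subenv G0 G -> occurs_under k G0 G c.
Proof.
move=> sT; elim: c G => [p|c1 IH1 c2 IH2|x b p c IH] G //=.
- by case=> ? ? ?; split; [apply: IH1|apply: IH2].
- by case=> Tx _ ? sG; have sG' := subenv_push sT Tx sG; split=> //; apply: IH.
Qed.

Lemma occurs_under_notin k G0 G c : k \notin kvars c -> occurs_under k G0 G c.
Proof.
elim: c G => [p|c1 IH1 c2 IH2|x b p c IH] G /=; rewrite ?mem_cat ?negb_or.
- by move/negPf->.
- by case/andP=> ? ?; split; [apply: IH1|apply: IH2].
- by case/andP=> /negPf-> ?; split=> //; apply: IH.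
Qed.

(** [scope] descends only while every occurrence of [k] stays below, so each of them sees at least
    the environment reached; deeper binders extend it consistently because their types come from
    [T]. *)
Lemma occurs_under_scope T k G c :
  subenv G T -> clean T c -> occurs_under k (scope_env G k c) G c.
Proof.
elim: c G => [p|c1 IH1 c2 IH2|x b p c IH] G sT /= cc; first by [].
- have [c1c c2c] := cc.
  case k1: (k \in kvars c1); case k2: (k \in kvars c2); last first.
  + by split; apply: occurs_under_notin; rewrite ?k1 ?k2.
  + by split; [apply: occurs_under_notin; rewrite k1|apply: IH2].
  + by split; [apply: IH1|apply: occurs_under_notin; rewrite k2].
  + by split; apply: occurs_under_sub sT _ _.
- have [Tx _ c'c] := cc; have sT' := subenv_cons_l sT Tx.
  case: ifP => kp; last by split=> //; apply: IH.
  have sG := subenv_push sT Tx (@subenv_refl _ G).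
  by split=> //; apply: occurs_under_sub sT c'c _.
Qed.

Lemma elim_head_typed s G p :
  well_typed_pred args G p -> well_typed_pred args G (elim_head s p).
Proof.
elim: p => //= [k ys|p1 IH1 p2 IH2]; first by case: (s k).
by case/andP=> /IH1-> /IH2->.
Qed.

Lemma inst_typed_occ T G0 k q G p :
  subenv G0 T -> (k \in pkvars p -> subenv G0 G) -> clean_pred T p ->
  well_typed_pred args (args k ++ G0) q -> well_typed_pred args G p ->
  well_typed_pred args G (inst args (single k q) p).
Proof.
move=> sT sG cp qT pT; case kp: (k \in pkvars p).
  exact: inst_typed sT (sG kp) cp qT pT.
by rewrite inst_single_id ?kp.
Qed.

Lemma elim_typed T G0 k q G c :
  subenv G0 T -> occurs_under k G0 G c -> clean T c ->
  well_typed_pred args (args k ++ G0) q -> well_typed args G c ->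
  well_typed args G (elim_ args (single k q) c).
Proof.
move=> sT + + qT; elim: c G => [p|c1 IH1 c2 IH2|x b p c IH] G /=.
- by move=> _ _; apply: elim_head_typed.
- by case=> ? ? [? ?] /andP[/IH1-> // /IH2->].
- case=> kp oc [Tx cp cc] /andP[pT cT]; rewrite IH // andbT.
  exact: inst_typed_occ sT kp cp qT pT.
Qed.

(* Only the bodies are instantiated: heads k ys enter sol k as equations, which
   must be well typed already. *)
Fixpoint bodies_typed s G c : bool :=
  match c with
  | CHead p => well_typed_pred args G p
  | CAnd c1 c2 => bodies_typed s G c1 && bodies_typed s G c2
  | CAll x b p c' =>
      well_typed_pred args ((x, b) :: G) (inst args s p)
      && bodies_typed s ((x, b) :: G) c'
  end.

Lemma conjunction_eqs_typed G G' ds ys :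
  fits G ds ys -> subenv G G' -> {in ds, forall u : decl (base L), lookup G' u.1 = Some u.2} ->
  well_typed_pred args G' (conjunction [seq PEq L K dy.1.1 dy.2 | dy <- zip ds ys]).
Proof.
move=> + sG; elim: ds ys => [|d ds IH] [|y ys] //=.
rewrite fits_cons => /andP[/eqP/sG Gy fG] dsG.
rewrite dsG ?mem_head // Gy eqxx /=; apply: IH => // d' d'ds.
by apply: dsG; rewrite inE d'ds orbT.
Qed.

Lemma inst_conjunction_eqs s (l : seq (decl (base L) * var)) :
  inst args s (conjunction [seq PEq L K dy.1.1 dy.2 | dy <- l]) =
  conjunction [seq PEq L K dy.1.1 dy.2 | dy <- l].
Proof. by elim: l => //= dy l ->. Qed.

Lemma sol_head_typed s k G G' p :
  uniq (map fst (args k)) -> subenv G G' -> subenv (args k) G' ->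
  well_typed_pred args G p -> well_typed_pred args G' (inst args s (sol_head args k p)).
Proof.
move=> uk sG sk; elim: p => //= [k' ys|p1 IH1 p2 IH2].
  case: eqP => [->|_] // fG; rewrite inst_conjunction_eqs.
  by apply: conjunction_eqs_typed fG sG _ => d /(lookup_mem uk)/sk.
by case/andP=> /IH1-> /IH2->.
Qed.

(** The existentials of the solution bind variables of [T], hence shadow no parameter of [k], and
    the equations at the heads remain typed. *)
Lemma sol_typed T s k G G' c :
  uniq (map fst (args k)) -> params_apart T -> clean T c ->
  subenv G G' -> subenv (args k) G' ->
  bodies_typed s G c -> well_typed_pred args G' (inst args s (sol args k c)).
Proof.
move=> uk pT; elim: c G G' => [p|c1 IH1 c2 IH2|x b p c IH] G G' /= cc sG sk.
- exact: sol_head_typed.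
- case: cc => ? ? /andP[t1 t2]; apply/andP; split; first exact: IH1 t1.
  exact: IH2 t2.
- case: cc => Tx cp cc /andP[pt ct]; have sG1 := @subenv_cons _ (x, b) _ _ sG.
  rewrite (well_typed_subenv sG1) //=; apply: IH ct => // y t ky /=.
  case: eqP => [e|_]; last exact: sk.
  have /pT : y \in map fst (args k) by apply: contraT; rewrite lookup_notin ky.
  by rewrite e Tx.
Qed.

Lemma scope_head_typed k G p :
  well_typed_pred args G p -> well_typed_pred args G (scope_head k p).
Proof.
elim: p => //= p1 IH1 p2 IH2 /andP[t1 t2].
by do 2!case: ifP => _ /=; rewrite ?t1 ?t2 ?IH1 ?IH2.
Qed.

Lemma scoped_sol_typed T s k G c :
  uniq (map fst (args k)) -> params_apart T -> clean T c -> subenv G T ->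
  bodies_typed s G c ->
  well_typed_pred args (args k ++ scope_env G k c) (inst args s (scoped_sol k c)).
Proof.
move=> uk pT.
have ska G' : subenv (args k) (args k ++ G').
  by move=> x t kx; rewrite lookup_cat kx.
elim: c G => [p|c1 IH1 c2 IH2|x b p c IH] G cc sT.
all: have sk : subenv G (args k ++ G) by exact: subenv_cat_fresh sT (pT k) (@subenv_refl _ G).
- move=> /= pt; exact: sol_head_typed uk sk (ska G) (scope_head_typed k pt).
- have [c1c c2c] := cc; rewrite scoped_sol_and [scope_env _ _ _]/= => ct.
  have /andP[t1 t2] := ct.
  do 2!case: ifP => _; [|exact: IH1|exact: IH2|];
    exact: (@sol_typed T s k G _ (CAnd c1 c2)).
- have [Tx cp c'c] := cc; rewrite scoped_sol_all [scope_env _ _ _]/= => ct.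
  have /andP[t1 t2] := ct; case: ifP => _.
    exact: (@sol_typed T s k G _ (CAll x b p c)).
  by apply: IH => //; apply: subenv_cons_l.
Qed.

Lemma well_typed_bodies G c :
  well_typed args G c -> bodies_typed (fun _ => None) G c.
Proof.
elim: c G => [p|c1 IH1 c2 IH2|x b p c IH] G //=.
  by case/andP=> /IH1-> /IH2->.
by rewrite inst_None => /andP[-> /IH->].
Qed.

Lemma elim1_typed T k c :
  uniq (map fst (args k)) -> params_apart T -> clean T c ->
  well_typed args [::] c -> well_typed args [::] (elim1 args k c).
Proof.
move=> uk pT cc ct; have s0 : subenv [::] T by [].
apply: (@elim_typed T (scope_env [::] k c)) => //.
- exact: scope_env_sub.
- exact: occurs_under_scope cc.
- rewrite -[X in well_typed_pred _ _ X]inst_None.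
  exact: scoped_sol_typed (well_typed_bodies ct).
Qed.

Lemma elim1_clean T k c : params_apart T -> clean T c -> clean T (elim1 args k c).
Proof.
move=> pT cc; apply: elim_clean => // k' q; rewrite /strongest.
by case: eqP => // _ [<-]; apply: scoped_sol_clean.
Qed.

(** Away from [k] the two instantiations act as [s] alone; at [k] the typing of [s k] is assumed.
    This is meant for [s] a pullback through later eliminations, whose value at [k] is still the
    initial one, while its other values need not be typed in their parameters alone. *)
Lemma inst_typed_cancel G k q s p :
  (forall r, s k = Some r -> well_typed_pred args (args k) r) ->
  well_typed_pred args G p ->
  well_typed_pred args G (inst args s (inst args (single k q) p)) ->
  well_typed_pred args G (inst args s p).
Proof.
move=> sk; elim: p G => //= [k' ys|p1 IH1 p2 IH2|p1 IH1 p2 IH2|x b p IH|D ys p IH] G.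
- rewrite /single; case: eqP => [->|_] //= ft /andP[_ _].
  case e: (s k) => [r|] //=; rewrite ft /=; apply: well_typed_subenv (sk _ e).
  by move=> x t kx; rewrite lookup_cat kx.
- by case/andP=> ? ? /andP[? ?]; rewrite IH1 ?IH2.
- by case/andP=> ? ? /andP[? ?]; rewrite IH1 ?IH2.
- exact: IH.
- by case/andP=> -> ? /andP[_ ?] /=; rewrite IH.
Qed.

Lemma elim_bodies_typed G k q s c :
  (forall r, s k = Some r -> well_typed_pred args (args k) r) ->
  well_typed args G c -> well_typed args G (cinst args s (elim_ args (single k q) c)) ->
  bodies_typed s G c.
Proof.
move=> sk; elim: c G => [p|c1 IH1 c2 IH2|x b p c IH] G //=.
- by case/andP=> ? ? /andP[? ?]; rewrite IH1 ?IH2.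
- by case/andP=> ? ? /andP[? ?]; rewrite IH // (@inst_typed_cancel _ k q).
Qed.

Lemma cinst_compose_typed T G0 k q s G c :
  subenv G0 T -> occurs_under k G0 G c -> clean T c ->
  well_typed_pred args (args k ++ G0) (inst args s q) ->
  well_typed args G c -> well_typed args G (cinst args s (elim_ args (single k q) c)) ->
  well_typed args G (cinst args (compose s (single k q)) c).
Proof.
move=> sT + + qT; elim: c G => [p|c1 IH1 c2 IH2|x b p c IH] G /=.
- elim: p => //= [k' ys|p1 IH1 p2 IH2].
    rewrite /compose /single inE eq_sym; case: eqP => [->|] //= kG _ -> _ /=.
    by apply: well_typed_subenv qT; apply: subenv_cat; apply: kG.
  rewrite mem_cat => kG /andP[n1 n2] /andP[t1 t2] /andP[e1 e2].
  by rewrite IH1 ?IH2 // => kp; apply: kG; rewrite kp ?orbT.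
- by case=> ? ? [? ?] /andP[? ?] /andP[? ?]; rewrite IH1 ?IH2.
- by case=> kp oc [Tx cp cc] /andP[pT cT] /andP[? ?]; rewrite inst_compose IH // andbT.
Qed.

(** Turns an assignment for [elim ks c] into one for [c]: each eliminated variable gets its
    strongest solution, in which the other variables are interpreted by the pullback through the
    remaining steps. *)
Fixpoint pullback (ks : seq K) c s : assignment L K :=
  if ks is k :: ks' then
    compose (pullback ks' (elim1 args k c) s) (strongest args c k)
  else s.

Lemma pullback_notin ks c s k : k \notin ks -> pullback ks c s k = s k.
Proof.
elim: ks c => //= k0 ks IH c; rewrite inE negb_or => /andP[/negPf kk0 kks].
by rewrite /compose /strongest kk0; apply: IH.
Qed.

Lemma pullback_typed T ks c s :
  (forall k, uniq (map fst (args k))) -> params_apart T -> clean T c ->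
  well_typed args [::] c -> uniq ks ->
  (forall k r, k \in ks -> s k = Some r -> well_typed_pred args (args k) r) ->
  well_typed args [::] (cinst args s (elim args ks c)) ->
  well_typed args [::] (cinst args (pullback ks c s) c).
Proof.
move=> ua pT; elim: ks c => //= k ks IH c cc ct /andP[kks uks] sk st.
have s0 : subenv [::] T by [].
have c1t := elim1_typed (ua k) pT cc ct; have c1c := elim1_clean k pT cc.
have IH1 : well_typed args [::] (cinst args (pullback ks (elim1 args k c) s) (elim1 args k c)).
  by apply: IH => // k' r k'ks; apply: sk; rewrite inE k'ks orbT.
apply: (@cinst_compose_typed T (scope_env [::] k c)) (IH1) => //.
- exact: scope_env_sub.
- exact: occurs_under_scope cc.
- apply: scoped_sol_typed => //; apply: elim_bodies_typed IH1 => // r.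
  by rewrite pullback_notin //; apply: sk; rewrite mem_head.
Qed.

Lemma inst_refinement s p :
  (forall k, exists2 q, s k = Some q & refinement q) -> refinement (inst args s p).
Proof.
rewrite /refinement => sr.
elim: p => //= [k ys|p1 IH1 p2 IH2|p1 IH1 p2 IH2].
- by have [q -> ] := sr k.
- by rewrite (nilP IH1) (nilP IH2).
- by rewrite (nilP IH1) (nilP IH2).
Qed.

Lemma cinst_refinement s c :
  (forall k, exists2 q, s k = Some q & refinement q) -> nilp (kvars (cinst args s c)).
Proof.
move=> sr; elim: c => [p|c1 IH1 c2 IH2|x b p c IH] /=.
- exact: inst_refinement.
- by rewrite (nilP IH1) (nilP IH2).
- by have /nilP-> := inst_refinement p sr; rewrite (nilP IH).
Qed.

Lemma pullback_refinement ks c s :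
  (forall k, exists2 q, s k = Some q & refinement q) ->
  forall k, exists2 q, pullback ks c s k = Some q & refinement q.
Proof.
move=> sr; elim: ks c => //= k0 ks IH c k; rewrite /compose /strongest.
by case: eqP => // _; eexists => //; apply: inst_refinement.
Qed.

(** * Semantics with interpreted refinement variables *)

Section Semantics.
Variable M : model L.
Notation env := (var -> value M).
Notation interp := (K -> env -> Prop).
Implicit Types (e : env) (rho : interp).

(* Scoping is dynamic: the relation rho k sees the whole environment of an
   application, its parameters being bound to the values of the arguments.
   Explicit substitutions in predicates behave in exactly this way. *)
Fixpoint pevalr rho e p : Prop :=
  match p with
  | PRef r => holds e r
  | PTrue => True
  | PFalse => False
  | PEq x y => e x = e y
  | PKv k ys => rho k (update_seq e (args k) [seq e y | y <- ys])
  | PAnd p1 p2 => pevalr rho e p1 /\ pevalr rho e p2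
  | POr p1 p2 => pevalr rho e p1 \/ pevalr rho e p2
  | PEx x b p' => exists v, carrier b v /\ pevalr rho (update e x v) p'
  | PSub ds ys p' => pevalr rho (update_seq e ds [seq e y | y <- ys]) p'
  end.

(** Guards and heads have separate interpretations, so that head variables can be made true, as
    elimination does, without changing the guards. *)
Fixpoint cevalr rho rhoh e c : Prop :=
  match c with
  | CHead p => pevalr rhoh e p
  | CAnd c1 c2 => cevalr rho rhoh e c1 /\ cevalr rho rhoh e c2
  | CAll x b p c' => forall v, carrier b v ->
      pevalr rho (update e x v) p -> cevalr rho rhoh (update e x v) c'
  end.

Definition interp_of s : interp := fun k e => if s k is Some q then peval e q else False.

Definition interp_compose rho s : interp :=
  fun k e => if s k is Some q then pevalr rho e q else rho k e.

Lemma pevalr_inst rho s e p :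
  pevalr rho e (inst args s p) = pevalr (interp_compose rho s) e p.
Proof.
elim: p e => //= [k ys|p1 IH1 p2 IH2|p1 IH1 p2 IH2|x b p IH] e.
- by rewrite /interp_compose; case: (s k).
- by rewrite IH1 IH2.
- by rewrite IH1 IH2.
- by congr ex; apply: functional_extensionality => v; rewrite IH.
Qed.

Lemma peval_inst s e p : peval e (inst args s p) = pevalr (interp_of s) e p.
Proof.
elim: p e => //= [k ys|p1 IH1 p2 IH2|p1 IH1 p2 IH2|x b p IH] e.
- by rewrite /interp_of; case: (s k).
- by rewrite IH1 IH2.
- by rewrite IH1 IH2.
- by congr ex; apply: functional_extensionality => v; rewrite IH.
Qed.

Lemma ceval_cinst s e c :
  ceval e (cinst args s c) <-> cevalr (interp_of s) (interp_of s) e c.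
Proof.
elim: c e => [p|c1 IH1 c2 IH2|x b p c IH] e /=.
- by rewrite peval_inst.
- by rewrite IH1 IH2.
- by split=> H v bv; have := H v bv; rewrite peval_inst => H' /H'/IH.
Qed.

Lemma interp_of_compose s1 s2 :
  interp_of (compose s1 s2) = interp_compose (interp_of s1) s2.
Proof.
apply: functional_extensionality => k; apply: functional_extensionality => e.
rewrite /interp_of /compose /interp_compose.
by case: (s2 k) => [q|] //; rewrite peval_inst.
Qed.

Lemma eq_pevalr rho rho' e p :
  {in pkvars p, forall k, rho k = rho' k} -> pevalr rho e p = pevalr rho' e p.
Proof.
elim: p e => //= [k ys|p1 IH1 p2 IH2|p1 IH1 p2 IH2|x b p IH|D ys p IH] e E.
- by rewrite E ?inE.
- by rewrite IH1 ?IH2 // => k kp; apply: E; rewrite mem_cat kp ?orbT.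
- by rewrite IH1 ?IH2 // => k kp; apply: E; rewrite mem_cat kp ?orbT.
- by congr ex; apply: functional_extensionality => v; rewrite IH.
- by rewrite IH.
Qed.

Lemma update_id e x : update e x (e x) = e.
Proof. by apply: functional_extensionality => y; rewrite /update; case: eqP => [->|]. Qed.

Lemma update_seq_out e (ds : tenv) vs y :
  y \notin map fst ds -> update_seq e ds vs y = e y.
Proof.
elim: ds vs => [|d ds IH] [|v vs] //=; rewrite inE negb_or => /andP[/negPf yd /IH] E.
by rewrite /update_seq /= /update yd; apply: E.
Qed.

Lemma update_seq_agree e e' (ds : tenv) vs y :
  size vs = size ds -> (y \notin map fst ds -> e y = e' y) ->
  update_seq e ds vs y = update_seq e' ds vs y.
Proof.
elim: ds vs => [|d ds IH] [|v vs] //=; first by move=> _ E; apply: E.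
case=> sv E; rewrite /update_seq /= /update; case: eqP => // yd.
by apply: IH => // yds; apply: E; rewrite inE negb_or yds andbT; apply/eqP.
Qed.

Lemma update_seq_params rho e (ds : tenv) ys :
  uniq (map fst ds) -> size ys = size ds -> {in ys, forall y, y \notin map fst ds} ->
  let e' := update_seq e ds [seq e y | y <- ys] in
  pevalr rho e' (conjunction [seq PEq L K dy.1.1 dy.2 | dy <- zip ds ys]).
Proof.
move=> uds sy yds e'.
have {yds} : {in ys, forall y, e' y = e y}.
  by move=> y yys; rewrite /e' update_seq_out ?yds.
have : forall i (d0 : decl (base L)) y0, i < size ds -> e' (nth d0 ds i).1 = e (nth y0 ys i).
  rewrite {}/e'; elim: ds ys uds sy => [|d ds IH] [|y ys] //= /andP[dds uds] [sy].
  case=> [|i] d0 y0 /= ids; rewrite /update_seq /= /update ?eqxx //.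
  case: eqP => [E|_]; last by apply: IH.
  by rewrite -E map_f ?mem_nth in dds.
elim: ds ys {uds} sy {e'} (e') => [|d ds IH] [|y ys] //= [sy] e' E Ey; split.
  by rewrite (Ey y) ?mem_head //; apply: (E 0 d 0).
apply: IH => // [i d0 y0 ids|z zys]; first exact: (E i.+1 d0 y0).
by apply: Ey; rewrite inE zys orbT.
Qed.

Lemma pevalr_conjunction_eqs rho e (ds : tenv) ys :
  pevalr rho e (conjunction [seq PEq L K dy.1.1 dy.2 | dy <- zip ds ys]) ->
  update_seq e ds [seq e y | y <- ys] = e.
Proof.
elim: ds ys => [|d ds IH] [|y ys] //= [E /IH].
by rewrite /update_seq /= => ->; rewrite -E update_id.
Qed.

Definition depends_on_vars (A : pred var) (P : env -> Prop) :=
  forall e e', {in A, e =1 e'} -> P e -> P e'.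

Notation dom G := [pred y | lookup G y != None].

Lemma typed_dep G p : well_typed_pred args G p ->
  depends_on_vars (dom G) (fun e => peval e p).
Proof.
elim: p G => [r| | |x y|k ys|p1 IH1 p2 IH2|p1 IH1 p2 IH2|x b p IH|D ys p IH] G /=;
  try by move=> _ ?.
- move=> Gr e e' E; apply: (proj1 (holds_ext _)) => x xr; apply: E.
  by rewrite inE; apply/eqP; apply: typed_fvars xr.
- by case/andP=> Gx /eqP Gxy e e' E; rewrite !E ?inE -?Gxy.
- by case/andP=> /IH1 H1 /IH2 H2 e e' E [/(H1 _ _ E) ? /(H2 _ _ E)].
- by case/andP=> /IH1 H1 /IH2 H2 e e' E [/(H1 _ _ E)|/(H2 _ _ E)]; [left|right].
- move=> /IH H e e' E [v [bv pv]]; exists v; split=> //; apply: (H _ _ _ pv) => y.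
  by rewrite inE /= /update; case: (y =P x) => // _ Gy; apply: E.
- case/andP=> ft /IH H e e' E; apply: H => y Gy.
  have -> : [seq e y | y <- ys] = [seq e' y | y <- ys].
    by apply/eq_in_map => z zys; apply: E; apply: (fits_lookup ft zys).
  apply: update_seq_agree => [|yD]; first by rewrite size_map (fits_size ft).
  by apply: E; move: Gy; rewrite !inE lookup_cat; move: yD; rewrite lookup_notin => /eqP->.
Qed.

Lemma inst_typed_dep s G p : well_typed_pred args G (inst args s p) ->
  depends_on_vars (dom G) (fun e => pevalr (interp_of s) e p).
Proof.
by move=> ft e e' E; rewrite -!peval_inst; apply: typed_dep ft _ _ E.
Qed.

Lemma depends_weak (A B : pred var) P :
  {subset A <= B} -> depends_on_vars A P -> depends_on_vars B P.
Proof. by move=> AB H e e' E; apply: H => x /AB; apply: E. Qed.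

(** An interpolation: the environment equal to [e] on [A] and to [e'] elsewhere agrees with [e] on
    [A], and with [e'] on [B]. *)
Lemma depends_inter (A B C : pred var) P :
  (forall x, x \in A -> x \in B -> x \in C) ->
  depends_on_vars A P -> depends_on_vars B P -> depends_on_vars C P.
Proof.
move=> ABC HA HB e e' E Pe; pose e1 x := if x \in A then e x else e' x.
have : P e1 by apply: HA Pe => x xA; rewrite /e1 xA.
by apply: HB => x xB; rewrite /e1; case: ifP => // xA; apply: E; apply: ABC.
Qed.

(** Such a [p] is positive and binds nothing, so the interpretations need comparing only at
    environments that differ from [e] in parameters. *)
Lemma pevalr_mono rho rho' e p : nnf_pred p ->
  (forall k e', k \in pkvars p ->
     (forall y, y \notin map fst (args k) -> e' y = e y) -> rho k e' -> rho' k e') ->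
  pevalr rho e p -> pevalr rho' e p.
Proof.
elim: p => //= [k ys _ H|p1 IH1 p2 IH2 /andP[n1 n2] H [h1 h2]].
  by apply: H; rewrite ?inE // => y; apply: update_seq_out.
split; [apply: IH1 h1|apply: IH2 h2] => // k e' kp; apply: H;
  by rewrite mem_cat kp ?orbT.
Qed.

(** Every disjunct of the solution ends in a head, and heads other than applications of [k]
    contribute false. *)
Lemma sol_heads rho k e c : pevalr rho e (sol args k c) -> k \in heads c.
Proof.
elim: c e => [p|c1 IH1 c2 IH2|x b p c IH] e /=; last by case=> v [_ [_ /IH]].
- elim: p => //= [k' ys|p1 IH1 p2 IH2]; first by case: eqP => // ->; rewrite inE.
  by rewrite mem_cat => -[/IH1->|/IH2->]; rewrite ?orbT.
- by rewrite mem_cat => -[/IH1->|/IH2->]; rewrite ?orbT.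
Qed.

Lemma pevalr_scope_head rho k e p :
  pevalr rho e (sol_head args k (scope_head k p)) = pevalr rho e (sol_head args k p).
Proof.
have out q : (k \in pkvars q) = false -> pevalr rho e (sol_head args k q) = False.
  move=> kq; apply: propositional_extensionality; split=> // h.
  by have := @sol_heads rho k e (CHead q) h; rewrite /= kq.
elim: p => //= p1 IH1 p2 IH2; case: ifP => k1; case: ifP => k2 //=.
  rewrite IH1 (out _ k2); apply: propositional_extensionality.
  by split=> [|[]] //; left.
rewrite IH2 (out _ k1); apply: propositional_extensionality.
by split=> [|[]] //; right.
Qed.

(* The environment e is the final one: it already holds the values of all binders
   on the path to the head, and those of its arguments in the parameters of k. *)
Fixpoint hit rho k e c : Prop :=
  match c with
  | CHead p => pevalr rho e (sol_head args k p)
  | CAnd c1 c2 => hit rho k e c1 \/ hit rho k e c2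
  | CAll x b p c' => [/\ carrier b (e x), pevalr rho e p & hit rho k e c']
  end.

Lemma hit_heads rho k e c : hit rho k e c -> k \in heads c.
Proof.
elim: c => [p|c1 IH1 c2 IH2|x b p c IH] /=.
- exact: (@sol_heads rho k e (CHead p)).
- by rewrite mem_cat => -[/IH1->|/IH2->]; rewrite ?orbT.
- by case.
Qed.

Lemma hit_sol rho k e c : hit rho k e c -> pevalr rho e (sol args k c).
Proof.
elim: c => [p|c1 IH1 c2 IH2|x b p c IH] //=.
  by case=> [/IH1|/IH2]; [left|right].
by case=> be pe /IH ?; exists (e x); rewrite update_id.
Qed.

(** Dropping the guards of the prefix only weakens the solution, and a conjunct discarded by [scope]
    does not contain [k], hence is not hit. *)
Lemma hit_scoped_sol rho k e c : hit rho k e c -> pevalr rho e (scoped_sol k c).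
Proof.
elim: c => [p|c1 IH1 c2 IH2|x b p c IH] hc.
- by rewrite /scoped_sol /= pevalr_scope_head.
- rewrite scoped_sol_and; case: ifP => k1; case: ifP => k2; try exact: hit_sol hc.
    by case: hc => [/IH1|/hit_heads/heads_kvars] //; rewrite k2.
  by case: hc => [/hit_heads/heads_kvars|/IH2] //; rewrite k1.
- rewrite scoped_sol_all; case: ifP => kp; first exact: hit_sol hc.
  by case: hc => _ _ /IH.
Qed.

Lemma scoped_sol_heads rho k e c : pevalr rho e (scoped_sol k c) -> k \in heads c.
Proof.
elim: c => [p|c1 IH1 c2 IH2|x b p c IH].
- by rewrite /scoped_sol /= pevalr_scope_head; apply: (@sol_heads rho k e (CHead p)).
- rewrite scoped_sol_and; case: ifP => k1; case: ifP => k2; try exact: sol_heads;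
    by [move/IH1 => /= kh; rewrite mem_cat kh | move/IH2 => /= kh; rewrite mem_cat kh orbT].
- rewrite scoped_sol_all; case: ifP => kp; first exact: sol_heads.
  exact: IH.
Qed.

End Semantics.

Lemma kvars_elim_head k s p : k \in pkvars (elim_head s p) -> k \in pkvars p.
Proof.
elim: p => //= [k' ys|p1 IH1 p2 IH2]; first by case: (s k').
by rewrite !mem_cat => /orP[/IH1->|/IH2->]; rewrite ?orbT.
Qed.

Lemma heads_elim k s c : k \in heads (elim_ args s c) -> k \in heads c.
Proof.
elim: c => [p|c1 IH1 c2 IH2|x b p c IH] //=; first exact: kvars_elim_head.
by rewrite !mem_cat => /orP[/IH1->|/IH2->]; rewrite ?orbT.
Qed.

Lemma binders_elim s c : binders (elim_ args s c) = binders c.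
Proof. by elim: c => //= [c1 -> c2 ->|x b p c ->]. Qed.

(** * Ranks and soundness of elimination *)

Section Ranks.
Variables (X : {set K}) (rk : K -> nat).

(* Semantic rather than syntactic dependence: a strongest solution contains
   variables in disjuncts conjoined with PFalse, hence elim1 may create cycles
   in the syntactic dependency graph. *)
Definition depends_on_kvars (A : pred K) p :=
  forall M (rho rho' : K -> (var -> value M) -> Prop), {in A, forall k, rho k = rho' k} ->
  forall e, pevalr rho e p = pevalr rho' e p.

Definition below k' : pred K := [pred k | (k \in X) || (rk k < rk k')].

Fixpoint ranked c : Prop :=
  match c with
  | CHead _ => True
  | CAnd c1 c2 => ranked c1 /\ ranked c2
  | CAll _ _ p c' =>
      {in heads c', forall k, k \notin X -> depends_on_kvars (below k) p} /\ ranked c'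
  end.

Lemma sol_depends k c : ranked c -> k \notin X -> depends_on_kvars (below k) (sol args k c).
Proof.
move=> + kX; elim: c => [p|c1 IH1 c2 IH2|x b p c IH] /=.
- move=> _ M rho rho' E e; elim: p => //= [k' ys|p1 -> p2 ->] //.
  case: eqP => // _; elim: (zip _ _) => //= dy l ->.
  by [].
- by case=> /IH1 H1 /IH2 H2 M rho rho' E e /=; rewrite (H1 _ _ _ E) (H2 _ _ _ E).
- case=> Hp /IH Hc M rho rho' E e /=; case kc: (k \in heads c).
    congr ex; apply: functional_extensionality => v.
    by rewrite (Hp k _ _ _ _ _ E) // (Hc _ _ _ E).
  (* Here [k] is no head of [c]: both sides are false, whatever [p] depends on. *)
  apply: propositional_extensionality.
  by split=> -[v [_ [_ /sol_heads]]]; rewrite kc.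
Qed.

Lemma scoped_sol_depends k c :
  ranked c -> k \notin X -> depends_on_kvars (below k) (scoped_sol k c).
Proof.
move=> + kX; elim: c => [p|c1 IH1 c2 IH2|x b p c IH] rc.
- exact: (@sol_depends k (CHead (scope_head k p))).
- have [r1 r2] := rc; rewrite scoped_sol_and.
  by do 2!case: ifP => _; [exact: sol_depends|exact: IH1|exact: IH2|exact: sol_depends].
- rewrite scoped_sol_all; case: ifP => _; first exact: sol_depends.
  by case: rc => _; apply: IH.
Qed.

(** Transitivity of the rank: if a guard above a head [k'] depends on [k], then [k] is below [k'],
    and so is all that [q] depends on. *)
Lemma elim_ranked k q c :
  k \notin X -> depends_on_kvars (below k) q -> ranked c ->
  ranked (elim_ args (single k q) c).
Proof.
move=> kX qd; elim: c => [p|c1 IH1 c2 IH2|x b p c IH] //=.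
  by case=> /IH1 ? /IH2.
case=> Hp /IH rc; split=> // k' /heads_elim k'c k'X M rho rho' E e.
rewrite !pevalr_inst; apply: (Hp k') => // j jk'; rewrite /interp_compose /single.
case: eqP => [ejk|_]; last exact: E.
apply: functional_extensionality => e1; apply: qd => i; rewrite inE => /orP[iX|ik].
  by apply: E; rewrite inE iX.
move: jk'; rewrite ejk !inE (negPf kX) /= => kk'.
by apply: E; rewrite inE (ltn_trans ik kk') orbT.
Qed.

Lemma elim1_ranked k c : k \notin X -> ranked c -> ranked (elim1 args k c).
Proof. by move=> kX rc; apply: elim_ranked => //; apply: scoped_sol_depends. Qed.

(** * Soundness of eliminating one variable *)

Section Soundness.
Variable M : model L.
Notation env := (var -> value M).
Implicit Types (e : env) (O : env -> Prop).
Notation dom G := [pred y | lookup G y != None].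

Lemma depends_update_params T G O k e vs :
  params_apart T -> subenv G T -> depends_on_vars (dom G) O -> O e ->
  O (update_seq e (args k) vs).
Proof.
move=> pT sT dO; apply: dO => y; rewrite inE => Gy.
rewrite update_seq_out //; apply/negP => /pT; case E: (lookup G y) Gy => [t|] // _.
by rewrite (sT _ _ E).
Qed.

Lemma fits_not_param T G k ys :
  params_apart T -> subenv G T -> fits G (args k) ys ->
  {in ys, forall y, y \notin map fst (args k)}.
Proof.
move=> pT sT ft y /(fits_lookup ft); case E: (lookup G y) => [t|] // _.
by apply/negP => /pT; rewrite (sT _ _ E).
Qed.

Lemma depends_path s G O x b p :
  depends_on_vars (dom G) O ->
  well_typed_pred args ((x, b) :: G) (inst args s p) ->
  depends_on_vars (dom ((x, b) :: G))
    (fun e => [/\ O e, carrier b (e x) & pevalr (interp_of s) e p]).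
Proof.
move=> dO pt e e' E [Oe be pe]; split.
- apply: dO Oe => y; rewrite inE => Gy; apply: E; rewrite inE /=.
  by case: (y =P x).
- by rewrite -E // inE /= eqxx.
- exact: inst_typed_dep pt _ _ E pe.
Qed.

Lemma depends_update G O e x v :
  depends_on_vars (dom G) O -> lookup G x = None -> O e -> O (update e x v).
Proof.
move=> dO Gx; apply: dO => y; rewrite inE /update.
by case: (y =P x) => // ->; rewrite Gx.
Qed.

Variables (T : tenv) (k : K) (q : predicate L K) (s : assignment L K).
Hypotheses (uk : uniq (map fst (args k))) (pT : params_apart T) (kX : k \notin X).
Let s0 := compose s (single k q).

Lemma head_sound G O p :
  subenv G T -> nnf_pred p -> well_typed_pred args G p -> depends_on_vars (dom G) O ->
  (forall e, O e -> hit (interp_of s) k e (CHead p) -> interp_of s0 k e) ->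
  forall e, O e -> pevalr (interp_of s) e (elim_head (single k q) p) ->
  pevalr (interp_of s0) e p.
Proof.
move=> sT + + dO; elim: p => //= [k' ys|p1 IH1 p2 IH2].
- move=> _ ft H e Oe; rewrite /single; case: eqP ft H => [->|/eqP kk'] ft H /=.
    move=> _; apply: H; first exact: depends_update_params pT sT dO Oe.
    exact: update_seq_params uk (fits_size ft) (fits_not_param pT sT ft).
  by rewrite /interp_of /s0 /compose /single (negPf kk').
- case/andP=> n1 n2 /andP[t1 t2] H e Oe [h1 h2].
  split; [apply: IH1 h1|apply: IH2 h2] => // e1 Oe1 he1; apply: H => //.
    by left.
  by right.
Qed.

(** [O] collects the conditions on the path from the root to [c]. Under [O], a hit in the
    subconstraint [c] is a hit in the whole constraint, which yields the new interpretation of [k]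
    needed at the eliminated heads. *)
Lemma elim_sound G O c :
  subenv G T -> clean T c -> uniq (binders c) ->
  {in binders c, forall x, lookup G x = None} ->
  well_typed args G c -> well_typed args G (cinst args s0 c) -> ranked c ->
  depends_on_vars (dom G) O ->
  (forall e, O e -> hit (interp_of s) k e c -> interp_of s0 k e) ->
  forall e, O e ->
  cevalr (interp_of s) (interp_of s) e (elim_ args (single k q) c) ->
  cevalr (interp_of s0) (interp_of s0) e c.
Proof.
elim: c G O => [p|c1 IH1 c2 IH2|x b p c IH] G O sT.
- by move=> cc _ _ ct _ _ dO; apply: head_sound sT cc ct dO.
- case=> cc1 cc2; rewrite /= cat_uniq => /and3P[u1 _ u2] bG /andP[t1 t2] /andP[e1 e2].
  case=> r1 r2 dO H e Oe [h1 h2]; split.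
    apply: (IH1 G O) h1 => // [y yc|e' Oe' h]; first by apply: bG; rewrite mem_cat yc.
    by apply: H => //; left.
  apply: (IH2 G O) h2 => // [y yc|e' Oe' h]; first by apply: bG; rewrite mem_cat yc orbT.
  by apply: H => //; right.
- case=> Tx cp cc /= /andP[xc uc] bG /andP[pt ct] /andP[pt0 ct0] [rp rc] dO H e Oe ch.
  move=> v bv pv; have Gx : lookup G x = None by apply: bG; rewrite mem_head.
  apply: (IH ((x, b) :: G)
    (fun e => [/\ O e, carrier b (e x) & pevalr (interp_of s0) e p])) => //.
  + exact: subenv_cons_l.
  + move=> y yc /=; case: eqP => [E|_]; first by rewrite -E yc in xc.
    by apply: bG; rewrite inE yc orbT.
  + exact: depends_path.
  + move=> e1 [Oe1 be1 pe1] h; apply: H => //; split=> //.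
    (* The guard is known under [s0] but the hit requires it under [s]. The two differ only at [k],
       and a guard above a head [k] depends only on variables below [k]. *)
    rewrite (rp k (hit_heads h) kX _ _ (interp_of s0)) // => j jk.
    rewrite /interp_of /s0 /compose /single; case: eqP => // ejk.
    by move: jk; rewrite ejk inE (negPf kX) ltnn.
  + split=> //; first exact: depends_update dO Gx Oe.
    by rewrite /update eqxx.
  + by apply: ch => //; rewrite pevalr_inst -interp_of_compose.
Qed.
End Soundness.

Lemma elim1_sound T k c s :
  uniq (map fst (args k)) -> params_apart T -> k \notin X -> clean T c ->
  uniq (binders c) -> well_typed args [::] c ->
  well_typed args [::] (cinst args (compose s (strongest args c k)) c) -> ranked c ->
  valid (cinst args s (elim1 args k c)) ->
  valid (cinst args (compose s (strongest args c k)) c).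
Proof.
move=> uk pT kX cc uc ct c0t rc V M e; apply/ceval_cinst.
apply: (@elim_sound M T k (scoped_sol k c) s uk pT kX [::] (fun _ => True)) => //.
- move=> e' _ /hit_scoped_sol; rewrite /interp_of /compose /single eqxx.
  by rewrite peval_inst.
- by apply/ceval_cinst/V.
Qed.

Lemma pullback_valid T ks c s :
  (forall k, uniq (map fst (args k))) -> params_apart T -> clean T c ->
  uniq (binders c) -> well_typed args [::] c -> ranked c -> uniq ks ->
  {in ks, forall k, k \notin X} ->
  (forall k r, k \in ks -> s k = Some r -> well_typed_pred args (args k) r) ->
  well_typed args [::] (cinst args s (elim args ks c)) ->
  valid (cinst args s (elim args ks c)) -> valid (cinst args (pullback ks c s) c).
Proof.
move=> ua pT; elim: ks c => //= k ks IH c cc uc ct rc uks ksX sk st sv.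
have kX : k \notin X by apply: ksX; rewrite mem_head.
have {uks} [kks uks'] := (uks, andP uks).
apply: (@elim1_sound T) => //.
- exact: (@pullback_typed T (k :: ks)).
- case: uks' => kks' uks'; apply: IH => //.
  + exact: elim1_clean.
  + by rewrite binders_elim.
  + exact: elim1_typed cc ct.
  + exact: elim1_ranked.
  + by move=> k' k'ks; apply: ksX; rewrite inE k'ks orbT.
  + by move=> k' r k'ks; apply: sk; rewrite inE k'ks orbT.
Qed.
End Ranks.

(** * Dependency graph and flattening *)

(** The edges of [dep] read off the constraint itself, so that later inductions need not go through
    flattening. *)
Fixpoint edges_in (r : rel K) c : Prop :=
  match c with
  | CHead _ => True
  | CAnd c1 c2 => edges_in r c1 /\ edges_in r c2
  | CAll _ _ p c' => {in pkvars p & heads c', forall k k', r k k'} /\ edges_in r c'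
  end.

Lemma heads_flatten k c :
  k \in heads c -> has (fun d => k \in pkvars (flat_head d)) (cflatten c).
Proof.
elim: c => [p|c1 IH1 c2 IH2|x b p c IH] /=.
- by case: p => //= *; rewrite orbF.
- by rewrite mem_cat has_cat => /orP[/IH1->|/IH2->]; rewrite ?orbT.
- by move/IH; rewrite has_map.
Qed.

Lemma dep_edges_in (r : rel K) c : subrel (dep c) r -> edges_in r c.
Proof.
elim: c => [p|c1 IH1 c2 IH2|x b p c IH] //= cr.
- by split; [apply: IH1|apply: IH2] => k k'; rewrite /dep => kk'; apply: cr;
    rewrite /dep /= has_cat kk' ?orbT.
- split.
    move=> k k' kp /heads_flatten kh; apply: cr; rewrite /dep /= has_map.
    by apply: sub_has kh => d /= ->; rewrite kp.
  apply: IH => k k'; rewrite /dep => kk'; apply: cr; rewrite /dep /= has_map.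
  by apply: sub_has kk' => d /= /andP[-> ->]; rewrite orbT.
Qed.

(** The rank counts the vertices from which [k] can be reached. It grows strictly along an edge from
    [k] to [k'], because a path from [k'] back to [k] would close a cycle. *)
Lemma acyclic_rank (r : rel K) :
  ~ has_cycle r -> exists rk : K -> nat, forall k k', r k k' -> rk k < rk k'.
Proof.
move=> ar; exists (fun k => #|[set j | connect r j k]|) => k k' kk'.
apply/proper_card/properP; split.
  by apply/subsetP => j; rewrite !inE => jk; apply: connect_trans jk (connect1 kk').
exists k'; rewrite inE ?connect0 //; apply/negP => /connectP[p pp lp].
by apply: ar; exists (k' :: p) => //=; rewrite rcons_path pp -lp.
Qed.

Lemma edges_ranked (X : {set K}) rk c :
  edges_in (fun k k' => [|| k \in X, k' \in X | rk k < rk k']) c -> ranked X rk c.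
Proof.
elim: c => [p|c1 IH1 c2 IH2|x b p c IH] //=; first by case=> /IH1 ? /IH2.
case=> Hp /IH ?; split=> // k' k'c k'X M rho rho' E e; apply: eq_pevalr => k kp.
by apply: E; have := Hp k k' kp k'c; rewrite (negPf k'X) /= inE.
Qed.

Lemma cut_rank (X : {set K}) c : cuts X c ->
  exists rk : K -> nat, edges_in (fun k k' => [|| k \in X, k' \in X | rk k < rk k']) c.
Proof.
move=> /acyclic_rank[rk H]; exists rk; apply: dep_edges_in => k k' kk'.
case kX: (k \in X) => //=; case k'X: (k' \in X) => //=.
by apply: H; rewrite /dep_without kX k'X.
Qed.

Lemma In_cat (A : Type) (x : A) l l' : List.In x (l ++ l') <-> List.In x l \/ List.In x l'.
Proof. exact: List.in_app_iff. Qed.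

Lemma In_map (A B : Type) (f : A -> B) l y :
  List.In y (map f l) <-> exists x, f x = y /\ List.In x l.
Proof. exact: List.in_map_iff. Qed.

Lemma flatten_flat c : all (@flat L K) (cflatten c).
Proof.
elim: c => [p|c1 IH1 c2 IH2|x b p c IH] /=; first by case: p.
  by rewrite all_cat IH1 IH2.
by rewrite all_map.
Qed.

Lemma flatten_ceval M (e : var -> value M) s c :
  ceval e (cinst args s c) <->
  forall d, List.In d (cflatten c) -> ceval e (cinst args s d).
Proof.
elim: c e => [p|c1 IH1 c2 IH2|x b p c IH] e /=.
- case: p => [r| | |y z|k ys|p1 p2|p1 p2|y b p|D ys p] /=; split=> [pe d|H];
    by [case=> [<-|[]]|case|exact: I|exact: (H _ (or_introl erefl))].
- rewrite IH1 IH2; split=> [[H1 H2] d /In_cat[/H1|/H2]|H] //.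
  by split=> d dc; apply: H; apply/In_cat; [left|right].
- split=> [H _ /In_map[d [<- dc]] v bv pv|H v bv pv].
    by have /IH := H v bv pv; apply.
  apply/IH => d dc; apply: (H (CAll x b p d)) => //.
  by apply/In_map; exists d.
Qed.

Lemma flatten_valid s c :
  valid (cinst args s c) <->
  forall d, List.In d (cflatten c) -> valid (cinst args s d).
Proof.
split=> [V d dc M e|V M e]; first by have /flatten_ceval := V M e; apply.
by apply/flatten_ceval => d /V; apply.
Qed.

Lemma flatten_typed G c d :
  well_typed args G c -> List.In d (cflatten c) -> well_typed args G d.
Proof.
elim: c G d => [p|c1 IH1 c2 IH2|x b p c IH] G d /=.
- by case: p => [r| | |y z|k ys|p1 p2|p1 p2|y b p|D ys p] //= ? [<-|].
- by case/andP=> t1 t2 /In_cat[/IH1|/IH2]; apply.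
- by case/andP=> pt ct /In_map[d' [<- d'c]] /=; rewrite pt (IH _ _ ct d'c).
Qed.

Definition total_typed s :=
  forall k, exists q, [/\ s k = Some q, refinement q & well_typed_pred args (args k) q].

Lemma inst_total_typed s G p :
  total_typed s -> well_typed_pred args G p -> well_typed_pred args G (inst args s p).
Proof.
move=> st; elim: p G => //= [k ys|p1 IH1 p2 IH2|p1 IH1 p2 IH2|x b p IH|D ys p IH] G.
- have [q [-> _ qt]] := st k => ft /=; rewrite ft /=; apply: well_typed_subenv qt.
  by move=> x t kx; rewrite lookup_cat kx.
- by case/andP=> /IH1-> /IH2.
- by case/andP=> /IH1-> /IH2.
- exact: IH.
- by case/andP=> -> /IH.
Qed.

Lemma cinst_total_typed s G c :
  total_typed s -> well_typed args G c -> well_typed args G (cinst args s c).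
Proof.
move=> st; elim: c G => [p|c1 IH1 c2 IH2|x b p c IH] G /=.
- exact: inst_total_typed.
- by case/andP=> /IH1-> /IH2.
- by case/andP=> /(inst_total_typed st)-> /IH.
Qed.

Lemma qualifier_total Q s : qualifier_assignment args Q s -> total_typed s.
Proof.
move=> sQ k; have [ps [-> Hps]] := sQ k; exists (conjunction ps).
have {}Hps p : List.In p ps -> refinement p /\ well_typed_pred args (args k) p.
  by case/Hps => q [ds [ys []]].
split=> //; elim: ps Hps => //= p ps IH Hps.
  have [/nilP pr _] := Hps p (or_introl erefl); rewrite /refinement /= pr.
  by apply: IH => p' p'ps; apply: Hps; right.
have [_ ->] := Hps p (or_introl erefl).
by apply: IH => p' p'ps; apply: Hps; right.
Qed.

(** The table [T] of [clean]: it is computed once, from the original constraint, and stays fixed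
    during elimination. *)
Fixpoint bdecls c : tenv :=
  match c with
  | CHead _ => [::]
  | CAnd c1 c2 => bdecls c1 ++ bdecls c2
  | CAll x b _ c' => (x, b) :: bdecls c'
  end.

Lemma map_bdecls c : map fst (bdecls c) = binders c.
Proof. by elim: c => //= [c1 <- c2 <-|x b p c ->]; rewrite ?map_cat. Qed.

Lemma nnf_clean_pred T p : nnf_pred p -> clean_pred T p.
Proof. by elim: p => //= p1 IH1 p2 IH2 /andP[/IH1 ? /IH2]. Qed.

Lemma nnf_clean c : nnf c -> uniq (binders c) -> clean (bdecls c) c.
Proof.
move=> nc uc; suff gen T :
    {in bdecls c, forall u : decl (base L), lookup T u.1 = Some u.2} -> clean T c.
  by apply: gen => u; apply: lookup_mem; rewrite map_bdecls.
elim: c nc {uc} => [p|c1 IH1 c2 IH2|x b p c IH] //=.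
  case/andP=> n1 n2 H; split; [apply: IH1|apply: IH2] => // u uc;
    by apply: H; rewrite mem_cat uc ?orbT.
case/andP=> np nc H; split; [exact: (H (x, b) (mem_head _ _))|exact: nnf_clean_pred|].
by apply: IH => // u uc; apply: H; rewrite inE uc orbT.
Qed.

Lemma elim_clean_typed T ks c :
  (forall k, uniq (map fst (args k))) -> params_apart T ->
  clean T c -> well_typed args [::] c -> well_typed args [::] (elim args ks c).
Proof.
move=> ua pT; elim: ks c => //= k ks IH c cc ct; apply: IH.
  exact: elim1_clean.
exact: elim1_typed cc ct.
Qed.

Lemma binders_params_apart c :
  (forall k x, x \in map fst (args k) -> x \notin binders c) -> params_apart (bdecls c).
Proof. by move=> ab k x /ab; rewrite -map_bdecls lookup_notin => /eqP. Qed.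

(** The assignment found by [solve] is pulled back to [c]. The eliminated variables avoid the cut
    set, so the dependencies among them carry a rank. *)
Lemma sat_satisfiable solve c Q ks :
  is_solve args solve -> nnf c -> well_typed args [::] c -> uniq (binders c) ->
  (forall k, uniq (map fst (args k))) ->
  (forall k x, x \in map fst (args k) -> x \notin binders c) ->
  all (@refinement L K) Q -> elim_list c ks -> sat args solve ks c Q ->
  satisfiable args c.
Proof.
move=> solveP nc ct uc ua /binders_params_apart pT Qr [X [[_ cX] uks ksX]].
case/(proj1 (solveP _ _ (flatten_flat _) Qr)) => s [/qualifier_total st sC].
have cc := nnf_clean nc uc; have [rk er] := cut_rank cX.
have c't := elim_clean_typed ks ua pT cc ct.
have sk k r : k \in ks -> s k = Some r -> well_typed_pred args (args k) r.
  by have [r' [-> _ r't]] := st k => _ [<-].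
have sr k : exists2 q, s k = Some q & refinement q.
  by have [q [? ? _]] := st k; exists q.
have br := pullback_refinement ks c sr.
have sc't := cinst_total_typed st c't.
exists (pullback ks c s); split.
- by move=> k p kp; have [q] := br k; rewrite kp => -[->].
- rewrite /well_formed (cinst_refinement c br) /=; exact: pullback_typed cc ct uks sk sc't.
- apply: (@pullback_valid X rk (bdecls c)) => //; first exact: edges_ranked.
    by move=> k; rewrite ksX inE.
  by apply/flatten_valid => d /sC[].
Qed.

(** * Scopes under elimination *)

Section ScopePreservation.
Variables (k0 : K) (q : predicate L K).
Notation el := (elim_ args (single k0 q)).

Lemma pkvars_inst k p : k != k0 ->
  (k \in pkvars (inst args (single k0 q) p)) =
  (k \in pkvars p) || (k0 \in pkvars p) && (k \in pkvars q).
Proof.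
move=> /negPf kk0; elim: p => //= [k' ys|p1 IH1 p2 IH2|p1 IH1 p2 IH2].
- rewrite /single !inE (eq_sym k0); case: (k' =P k0) => [->|_] /=.
    by rewrite kk0.
  by rewrite inE orbF.
- by rewrite !mem_cat IH1 IH2; do 5!case: (_ \in _).
- by rewrite !mem_cat IH1 IH2; do 5!case: (_ \in _).
Qed.

Lemma pkvars_elim_head k p : k != k0 ->
  (k \in pkvars (elim_head (single k0 q) p)) = (k \in pkvars p).
Proof.
move=> /negPf kk0; elim: p => //= [k' ys|p1 IH1 p2 IH2].
  by rewrite /single inE; case: (k' =P k0) => [->|_] /=; rewrite ?kk0 ?inE.
by rewrite !mem_cat IH1 IH2.
Qed.

Lemma kvars_elim k c : k != k0 -> k \in kvars c -> k \in kvars (el c).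
Proof.
move=> kk0; elim: c => [p|c1 IH1 c2 IH2|x b p c IH] /=.
- by rewrite pkvars_elim_head.
- by rewrite !mem_cat => /orP[/IH1->|/IH2->]; rewrite ?orbT.
- by rewrite !mem_cat pkvars_inst // => /orP[->|/IH->]; rewrite ?orbT.
Qed.

Lemma kvars_elim_notin k c : k != k0 -> k \notin pkvars q ->
  (k \in kvars (el c)) = (k \in kvars c).
Proof.
move=> kk0 /negPf kq; elim: c => [p|c1 IH1 c2 IH2|x b p c IH] /=.
- by rewrite pkvars_elim_head.
- by rewrite !mem_cat IH1 IH2.
- by rewrite !mem_cat pkvars_inst // IH kq andbF orbF.
Qed.

Lemma scope_vars_elim_notin k c :
  k != k0 -> k \notin pkvars q -> scope_vars k (el c) = scope_vars k c.
Proof.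
move=> kk0 kq; elim: c => [p|c1 IH1 c2 IH2|x b p c IH] //.
- by rewrite /= !scope_vars_and !kvars_elim_notin // IH1 IH2.
- by rewrite /= !scope_vars_all pkvars_inst // (negPf kq) andbF orbF IH.
Qed.

(** Eliminating another variable may add occurrences of [k] but removes none, so its scope cannot
    become narrower. *)
Lemma scope_vars_elim_nil k c :
  k != k0 -> k \in kvars c -> scope_vars k c = [::] -> scope_vars k (el c) = [::].
Proof.
move=> kk0; elim: c => [p|c1 IH1 c2 IH2|x b p c IH] //=.
- rewrite mem_cat !scope_vars_and; case k1: (k \in kvars c1); case k2: (k \in kvars c2) => //= _.
  + by rewrite !kvars_elim.
  + by rewrite (kvars_elim kk0 k1) => /(IH1 k1)->; case: ifP.
  + by rewrite (kvars_elim kk0 k2) => /(IH2 k2)->; case: ifP.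
- rewrite mem_cat !scope_vars_all pkvars_inst //; case: ifP => //= kp.
Qed.

Lemma kvars_matrix k c : {subset kvars (matrix k (scope k c)) <= kvars c}.
Proof.
move=> k'; elim: c => [p|c1 IH1 c2 IH2|x b p c IH] /=.
- elim: p => //= p1 IH1 p2 IH2; case: ifP => _; case: ifP => _ //;
  rewrite mem_cat; by [move/IH1->|move/IH2->; rewrite orbT].
- rewrite mem_cat; case: ifP => _; case: ifP => _ /=;
    by [rewrite mem_cat|move/IH1->|move/IH2->; rewrite orbT].
- by case: ifP => kp /=; rewrite kp // mem_cat => /IH->; rewrite orbT.
Qed.

(* Copying q, which mentions k, to the occurrences of k0 can only shorten the
   scope prefix of k when that of k0 is shorter. *)
Lemma scope_vars_elim_matrix k c : k != k0 -> k \in kvars (matrix k0 (scope k0 c)) ->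
  ~~ (prefix (scope_vars k0 c) (scope_vars k c) && (scope_vars k0 c != scope_vars k c)) ->
  scope_vars k (el c) = scope_vars k c.
Proof.
move=> kk0; elim: c => [p|c1 IH1 c2 IH2|x b p c IH] //.
- rewrite /= !scope_vars_and.
  case i1: (k0 \in kvars c1); case i2: (k0 \in kvars c2) => /=; last first.
  + by move=> _ _; rewrite !elim_id ?i1 ?i2.
  + rewrite (elim_id q (c := c1)) ?i1 // => km2; have k2 := kvars_matrix km2.
    rewrite k2 (kvars_elim kk0 k2); case: ifP => // _; exact: IH2.
  + rewrite (elim_id q (c := c2)) ?i2 // => km1; have k1 := kvars_matrix km1.
    rewrite k1 (kvars_elim kk0 k1); case: ifP => // _; exact: IH1.
  (* [k0] occurs in both conjuncts, so its prefix is empty; by hypothesis that of [k] is then empty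
     too. *)
  + rewrite mem_cat prefix0s /= => kc /negPn/eqP s0.
    have := @scope_vars_elim_nil k (CAnd c1 c2) kk0.
    by rewrite /= !scope_vars_and mem_cat -s0; apply.
- rewrite /= !scope_vars_all pkvars_inst //; case: ifP => k0p /=.
    move=> _; rewrite prefix0s /=; case: ifP => //=.
  rewrite k0p orbF => km; case: ifP => // kp; rewrite prefix_cons eqxx /= eqseq_cons eqxx.
  by move=> h; rewrite IH.
Qed.

Lemma pkvars_sol c : {subset pkvars (sol args k0 c) <= kvars c}.
Proof.
move=> k; elim: c => [p|c1 IH1 c2 IH2|x b p c IH] /=.
- elim: p => //= [k' ys|p1 IH1 p2 IH2]; last first.
    by rewrite !mem_cat => /orP[/IH1->|/IH2->]; rewrite ?orbT.
  by case: eqP => // _; elim: (zip _ _).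
- by rewrite !mem_cat => /orP[/IH1->|/IH2->]; rewrite ?orbT.
- by rewrite !mem_cat => /orP[->|/IH->]; rewrite ?orbT.
Qed.
End ScopePreservation.

(** Either the copied solution does not mention [k], and no occurrence is added, or [k] occurs
    within the matrix of the scope of [k0]. *)
Lemma scope_vars_elim1 k0 k c : k != k0 -> ~~ strictly_inside c k k0 ->
  scope_vars k (elim1 args k0 c) = scope_vars k c.
Proof.
move=> kk0 nin; case kq: (k \in pkvars (scoped_sol k0 c)).
  exact: scope_vars_elim_matrix kk0 (pkvars_sol kq) nin.
by apply: scope_vars_elim_notin; rewrite ?kq.
Qed.

Lemma local_first_elim1 k c ks : k \notin ks -> local_first c (k :: ks) ->
  {in ks, forall k', scope_vars k' (elim1 args k c) = scope_vars k' c} /\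
  local_first (elim1 args k c) ks.
Proof.
move=> kks; rewrite /local_first /= => /andP[/allP nin lf].
have E : {in ks, forall k', scope_vars k' (elim1 args k c) = scope_vars k' c}.
  move=> k' k'ks; apply: scope_vars_elim1; last exact: nin.
  by apply: contraNneq kks => <-.
split=> //; rewrite -(eq_in_pairwise (P := mem ks)
  (r := fun k1 k2 => ~~ strictly_inside c k2 k1)) //.
  move=> k1 k2 k1ks k2ks; rewrite /strictly_inside.
  by have := E _ k1ks; have := E _ k2ks; rewrite /scope_vars => -> ->.
Qed.

(** * The pulled-back interpretation as a fixpoint of strongest solutions *)

Section PullbackFixpoint.
Variable M : model L.
Implicit Types (e : var -> value M) (rho : K -> (var -> value M) -> Prop).

Lemma sol_notin rho k e c : k \notin heads c -> pevalr rho e (sol args k c) = False.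
Proof.
move=> kc; apply: propositional_extensionality.
by split=> // /sol_heads; rewrite (negPf kc).
Qed.

Lemma scoped_sol_scope_vars_nil rho k e c : k \in kvars c -> scope_vars k c = [::] ->
  pevalr rho e (scoped_sol k c) = pevalr rho e (sol args k c).
Proof.
elim: c => [p|c1 IH1 c2 IH2|x b p c IH] /=.
- by move=> _ _; rewrite /scoped_sol /= pevalr_scope_head.
- rewrite mem_cat scope_vars_and scoped_sol_and.
  case k1: (k \in kvars c1); case k2: (k \in kvars c2) => //= _ s0.
  + rewrite (IH1 k1 s0) [X in _ \/ X]sol_notin; last first.
      by apply/negP => /heads_kvars; rewrite k2.
    by apply: propositional_extensionality; split=> [|[]] //; left.
  + rewrite (IH2 k2 s0) [X in X \/ _]sol_notin; last first.
      by apply/negP => /heads_kvars; rewrite k1.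
    by apply: propositional_extensionality; split=> [|[]] //; right.
- by rewrite mem_cat scope_vars_all scoped_sol_all; case: ifP.
Qed.

(** Guards are instantiated, which amounts to composing interpretations; a head [k0 ys] contributes
    false to the solution of [k] both before and after it becomes true. *)
Lemma sol_elim rho k k0 q e c : k != k0 ->
  pevalr rho e (sol args k (elim_ args (single k0 q) c)) =
  pevalr (interp_compose rho (single k0 q)) e (sol args k c).
Proof.
move=> kk0; elim: c e => [p|c1 IH1 c2 IH2|x b p c IH] e /=.
- elim: p => //= [k' ys|p1 -> p2 ->] //.
  rewrite /single; case: (k' =P k0) => [->|_] /=.
    by rewrite eq_sym (negPf kk0).
  by case: eqP => // _; elim: (zip _ _) => //= dy l ->.
- by rewrite IH1 IH2.
- by congr ex; apply: functional_extensionality => v; rewrite pevalr_inst IH.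
Qed.

Lemma scoped_sol_elim rho k k0 q e c : k != k0 ->
  scope_vars k (elim_ args (single k0 q) c) = scope_vars k c ->
  pevalr rho e (scoped_sol k (elim_ args (single k0 q) c)) =
  pevalr (interp_compose rho (single k0 q)) e (scoped_sol k c).
Proof.
move=> kk0; elim: c => [p|c1 IH1 c2 IH2|x b p c IH].
- move=> _; rewrite /scoped_sol /= !pevalr_scope_head.
  exact: (@sol_elim rho k k0 q e (CHead p)).
- case kh: (k \in heads (CAnd c1 c2)); last first.
    move=> _; apply: propositional_extensionality.
    split=> /scoped_sol_heads; last by rewrite kh.
    by move/(@heads_elim k (single k0 q) (CAnd c1 c2)); rewrite kh.
  have := @sol_elim rho k k0 q e (CAnd c1 c2) kk0.
  rewrite [elim_ _ _ _]/= !scope_vars_and !scoped_sol_and => SE.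
  case k1: (k \in kvars c1); case k2: (k \in kvars c2).
  + by rewrite !kvars_elim.
  + rewrite (kvars_elim q kk0 k1); case: ifP => k2'; last exact: IH1.
    (* A copy has put [k] into the second conjunct, so its scope is now the whole conjunction. Since
       the prefix is preserved it was empty before, where the scoped solution already amounts to the
       unscoped one. *)
    move=> s0; rewrite SE (scoped_sol_scope_vars_nil _ _ k1) // /= [X in _ \/ X]sol_notin.
      by apply: propositional_extensionality; split=> [[]|] //; left.
    by apply/negP => /heads_kvars; rewrite k2.
  + rewrite (kvars_elim q kk0 k2); case: ifP => k1'; last exact: IH2.
    move=> s0; rewrite SE (scoped_sol_scope_vars_nil _ _ k2) // /= [X in X \/ _]sol_notin.
      by apply: propositional_extensionality; split=> [[]|] //; right.
    by apply/negP => /heads_kvars; rewrite k1.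
  + by move/heads_kvars: kh; rewrite /= mem_cat k1 k2.
- have SE := @sol_elim rho k k0 q e (CAll x b p c) kk0.
  rewrite [elim_ _ _ _]/= !scope_vars_all !scoped_sol_all pkvars_inst //.
  case kp: (k \in pkvars p) => /=; first by move=> _.
  by case: ifP => // _ [/IH].
Qed.

(** For the first variable of the list, its solution depends only on variables below it, which the
    first step does not reinterpret. For a later one, the equation holds in the constraint after
    that step and is carried back because its scope is unchanged. *)
Lemma pullback_fixpoint (X : {set K}) rk ks c s k :
  uniq ks -> {in ks, forall k', k' \notin X} -> ranked X rk c -> local_first c ks ->
  k \in ks ->
  let R := interp_of (M := M) (pullback ks c s) in
  forall e, R k e = pevalr R e (scoped_sol k c).
Proof.
elim: ks c => //= k0 ks IH c /andP[k0ks uks] ksX rc lf.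
have k0X : k0 \notin X by apply: ksX; rewrite mem_head.
rewrite inE interp_of_compose; set R1 := interp_of _.
case: eqP => [-> _|/eqP kk0 /= kks] e.
  rewrite {1}/interp_compose /strongest eqxx.
  apply: (scoped_sol_depends rc k0X) => j; rewrite /interp_compose /strongest.
  by case: eqP => // ->; rewrite inE (negPf k0X) ltnn.
have [Ek lf1] := local_first_elim1 k0ks lf.
rewrite -[strongest args c k0]/(single k0 (scoped_sol k0 c)).
rewrite -(scoped_sol_elim _ _ kk0); last exact: Ek.
rewrite {1}/interp_compose /single (negPf kk0); apply: IH => //.
- by move=> k' k'ks; apply: ksX; rewrite inE k'ks orbT.
- exact: elim1_ranked k0X rc.
Qed.

(** Guards left by elimination evaluate under [s] as the original guards do under the pullback, and
    heads replaced by true are already true in the premise. *)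
Lemma pullback_heads_true ks c s e :
  (forall k, s k = Some (PTrue L K)) ->
  cevalr (interp_of (pullback ks c s)) (fun _ _ => True) e c ->
  cevalr (interp_of s) (fun _ _ => True) e (elim args ks c).
Proof.
move=> sT; elim: ks c => //= k ks IH c; rewrite interp_of_compose => h.
apply: IH; move: h; rewrite /elim1; set t := strongest _ _ _.
move: t (interp_of (M := M) (pullback ks (elim_ args t c) s)) => t rho.
elim: c e => [p|c1 IH1 c2 IH2|x b p c IH] e /=.
- elim: p => //= [k' ys|p1 IH1 p2 IH2]; first by case: (t k').
  by case=> /IH1 ? /IH2.
- by case=> /IH1 ? /IH2.
- by move=> h v bv; rewrite pevalr_inst => pv; apply: IH; apply: h.
Qed.
End PullbackFixpoint.

(** * Completeness for acyclic constraints *)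

Section Completeness.
(** [tau] stands for the pullback of the constantly true assignment and [sig] for an arbitrary
    solution of [c]. *)
Variables (M : model L) (T : tenv) (tau sig : assignment L K) (rk : K -> nat).
Variable (c : constr L K).
Notation env := (var -> value M).
Notation R := (interp_of (M := M) tau).
Notation S := (interp_of (M := M) sig).
Notation dom G := [pred y | lookup G y != None].
Implicit Types (e : env) (O : env -> Prop).

Lemma pkvars_dep k q G p : sig k = Some q -> nnf_pred p -> k \in pkvars p ->
  well_typed_pred args G (inst args sig p) ->
  depends_on_vars [pred y | (y \in map fst (args k)) || (lookup G y != None)]
    (fun e => peval e q).
Proof.
move=> sk; elim: p => //= [k' ys _|p1 IH1 p2 IH2 /andP[n1 n2]].
  rewrite inE => /eqP <-; rewrite sk /= => /andP[_ /typed_dep qd].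
  apply: depends_weak (qd M) => y; rewrite !inE lookup_cat.
  case: (boolP (y \in _)) => //=; rewrite lookup_notin => /eqP->.
  by [].
rewrite mem_cat => kp /andP[t1 t2].
by case/orP: kp => [k1|k2]; [apply: IH1|apply: IH2].
Qed.

Lemma kvars_dep k q G d : sig k = Some q -> nnf d -> k \in kvars d ->
  well_typed args G (cinst args sig d) ->
  depends_on_vars
    [pred y | [|| y \in map fst (args k), lookup G y != None | y \in binders d]]
    (fun e => peval e q).
Proof.
move=> sk; elim: d G => [p|c1 IH1 c2 IH2|x b p d IH] G /=.
- move=> np kp pt; apply: depends_weak (pkvars_dep sk np kp pt) => y; rewrite !inE.
  by case/orP=> ->; rewrite ?orbT.
- case/andP=> n1 n2; rewrite mem_cat => /orP[/(IH1 _ n1)|/(IH2 _ n2)] H /andP[t1 t2].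
    apply: depends_weak (H _ t1) => y; rewrite !inE mem_cat.
    by case/or3P=> ->; rewrite ?orbT.
  apply: depends_weak (H _ t2) => y; rewrite !inE mem_cat.
  by case/or3P=> ->; rewrite ?orbT.
- case/andP=> np nd; rewrite mem_cat => kin /andP[tp td].
  have H : depends_on_vars [pred y | [|| y \in map fst (args k),
      lookup ((x, b) :: G) y != None | y \in binders d]] (fun e => peval e q).
    case/orP: kin => [kp|kd]; last exact: IH.
    apply: depends_weak (pkvars_dep sk np kp tp) => y; rewrite !inE.
    by case/orP=> ->; rewrite ?orbT.
  apply: depends_weak H => y; rewrite !inE /=.
  by case: (y =P x) => [_ _|_] //=; rewrite !orbT.
Qed.

(** Typing at each occurrence of [k] bounds what its value can see. Occurrences in two conjuncts
    have only outer variables in common, binders being distinct; a guard containing [k] above a head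
    [k] is excluded by the rank. *)
Lemma scoped_sol_scope_dep k q G d :
  sig k = Some q -> nnf d -> k \in heads d -> uniq (binders d) ->
  edges_in (fun k1 k2 => rk k1 < rk k2) d -> well_typed args G (cinst args sig d) ->
  depends_on_vars
    [pred y | [|| y \in map fst (args k), lookup G y != None | y \in scope_vars k d]]
    (fun e => peval e q).
Proof.
move=> sk; elim: d G => [p|c1 IH1 c2 IH2|x b p d IH] G.
- move=> np kp _ _ pt; apply: depends_weak (pkvars_dep sk np kp pt) => y; rewrite !inE.
  by case/orP=> ->; rewrite ?orbT.
- case/andP=> n1 n2; rewrite /= mem_cat cat_uniq => kh /and3P[u1 /hasPn u12 u2] [e1 e2].
  case/andP=> t1 t2; rewrite scope_vars_and.
  case k1: (k \in kvars c1); case k2: (k \in kvars c2).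
  + apply: depends_inter (kvars_dep sk n1 k1 t1) (kvars_dep sk n2 k2 t2) => y.
    rewrite !inE; case: (y \in _) => //=; case: (lookup G y != None) => //=.
    by move=> yc1 /u12; rewrite /= yc1.
  + apply: IH1 => //; case/orP: kh => // /heads_kvars; by rewrite k2.
  + apply: IH2 => //; case/orP: kh => // /heads_kvars; by rewrite k1.
  + by case/orP: kh => /heads_kvars; rewrite ?k1 ?k2.
- case/andP=> np nd /= kh /andP[_ ud] [ep ed] /andP[_ td]; rewrite scope_vars_all.
  case: ifP => kp; first by have := ep _ _ kp kh; rewrite ltnn.
  apply: depends_weak (IH _ nd kh ud ed td) => y; rewrite !inE /=.
  by case: (y =P x) => [_ _|_] //=; rewrite !orbT.
Qed.

(** The guards that [scope] passes on its way to the scope of [k], read as in [hit] at the final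
    environment. *)
Fixpoint guards k e d : Prop :=
  match d with
  | CHead _ => True
  | CAnd c1 c2 =>
      match k \in kvars c1, k \in kvars c2 with
      | true, false => guards k e c1
      | false, true => guards k e c2
      | _, _ => True
      end
  | CAll x b p d' =>
      if k \in pkvars p then True else [/\ carrier b (e x), pevalr R e p & guards k e d']
  end.

Definition admissible G d : Prop :=
  [/\ nnf d, uniq (binders d), {in binders d, forall x, lookup G x = None},
      subenv G T & clean T d] /\
  [/\ well_typed args G (cinst args tau d), well_typed args G (cinst args sig d)
    & edges_in (fun k k' => rk k < rk k') d].

Lemma admissible_and G c1 c2 :
  admissible G (CAnd c1 c2) -> admissible G c1 /\ admissible G c2.
Proof.
case=> [[/andP[n1 n2]]]; rewrite /= cat_uniq => /and3P[u1 _ u2] bG sT [cc1 cc2].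
case=> /andP[t1 t2] /andP[s1 s2] [e1 e2].
by do 2!split=> //; split=> // x xb; apply: bG; rewrite mem_cat xb ?orbT.
Qed.

Lemma admissible_all G x b p d :
  admissible G (CAll x b p d) ->
  [/\ admissible ((x, b) :: G) d, lookup G x = None, x \notin binders d & nnf_pred p].
Proof.
case=> [[/andP[np nd]]] /= /andP[xd ud] bG sT [Tx cp cd].
case=> /andP[tp td] /andP[sp sd] [ep ed].
split=> //; last by apply: bG; rewrite mem_head.
split; split=> //; last exact: subenv_cons_l.
move=> y yd /=; case: eqP => [E|_]; first by rewrite -E yd in xd.
by apply: bG; rewrite inE yd orbT.
Qed.

Definition extend O x b p e : Prop := [/\ O e, carrier b (e x) & pevalr R e p].

(** The path condition [O] supplies the guards of [c] that lie above [d]. *)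
Definition guards_from O d := forall k e, O e -> k \in kvars d -> guards k e d -> guards k e c.

Lemma guards_from_and O c1 c2 :
  guards_from O (CAnd c1 c2) -> guards_from O c1 /\ guards_from O c2.
Proof.
by move=> H; split=> k e Oe kc g; apply: H => //=; rewrite ?mem_cat kc ?orbT //;
  case: ifP.
Qed.

Lemma guards_from_all O x b p d :
  guards_from O (CAll x b p d) -> guards_from (extend O x b p) d.
Proof.
move=> H k e [Oe be pe] kd g; apply: H => //=; first by rewrite mem_cat kd orbT.
by case: ifP.
Qed.

Hypothesis pT : params_apart T.

(** Scoped solutions omit the guards of their prefix, so [R k] may exceed [S k] where these fail. *)
Definition below_sig k := forall e, guards k e c -> R k e -> S k e.

(** The scope of a variable occurring in [p] starts no deeper than this node, so [O] implies its
    guards. Rebinding parameters does not affect [O], as they are apart from [G]. *)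
Lemma body_below O G x b p d e :
  admissible G (CAll x b p d) -> guards_from O (CAll x b p d) ->
  depends_on_vars (dom G) O -> {in pkvars p, forall k, below_sig k} -> O e ->
  pevalr R e p -> pevalr S e p.
Proof.
move=> [[/andP[np _] _ _ sT _] _] H dO bp Oe; apply: pevalr_mono => // k e' kp E.
apply: bp => //; apply: H; rewrite /= ?mem_cat ?kp //.
apply: dO Oe => y; rewrite inE => Gy; rewrite E //; apply/negP => /pT.
by case Ey: (lookup G y) Gy => [t|] // _; rewrite (sT _ _ Ey).
Qed.

Lemma extend_depends O G x b p d :
  admissible G (CAll x b p d) -> depends_on_vars (dom G) O ->
  depends_on_vars (dom ((x, b) :: G)) (extend O x b p).
Proof. by move=> [_ [/andP[tp _] _ _]] dO; apply: depends_path. Qed.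

Lemma extend_update O G x b p e v :
  depends_on_vars (dom G) O -> lookup G x = None -> O e ->
  carrier b v -> pevalr R (update e x v) p -> extend O x b p (update e x v).
Proof.
move=> dO Gx Oe bv pv; split=> //; first exact: depends_update dO Gx Oe.
by rewrite /update eqxx.
Qed.

(** [e'] stores the witnesses of the existentials on the path to some head [k ys]. The guards there
    pass from [R] to [S], their variables having smaller rank, so this head holds under [S]; the
    equations make rebinding the parameters trivial. *)
Lemma sol_below k O G d e :
  (forall k', rk k' < rk k -> below_sig k') ->
  admissible G d -> guards_from O d -> depends_on_vars (dom G) O -> O e ->
  cevalr S S e d -> pevalr R e (sol args k d) ->
  exists2 e', {in [predC binders d], e' =1 e} & S k e'.
Proof.
move=> lt; elim: d G O e => [p|c1 IH1 c2 IH2|x b p d IH] G O e ad gd dO Oe.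
- move=> /= pe he; exists e => //; elim: p {ad gd} pe he => //= [k' ys|p1 IH1 p2 IH2].
    by case: eqP => // -> + /pevalr_conjunction_eqs E; rewrite E.
  by case=> h1 h2 [/(IH1 h1)|/(IH2 h2)].
- have [a1 a2] := admissible_and ad; have [g1 g2] := guards_from_and gd.
  case=> h1 h2 [/(IH1 _ _ _ a1 g1 dO Oe h1)|/(IH2 _ _ _ a2 g2 dO Oe h2)] [e' E Se'];
    by exists e' => // y yb; apply: E; move: yb; rewrite !inE mem_cat negb_or => /andP[].
- have [ad' Gx xd np] := admissible_all ad => h [v [bv [pv sv]]].
  have Oe' := extend_update dO Gx Oe bv pv.
  have pS : pevalr S (update e x v) p.
    apply: (body_below ad gd dO) pv => [k' k'p|]; last by case: Oe'.
    by apply: lt; have [_ [_ _ [ep _]]] := ad; apply: ep k'p (sol_heads sv).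
  have [e' E Se'] := IH _ _ _ ad' (guards_from_all gd) (extend_depends ad dO) Oe'
    (h v bv pS) sv.
  exists e' => // y; rewrite !inE negb_or => /andP[/negPf yx yd].
  by rewrite E // /update yx.
Qed.

(** Binders of the prefix are not quantified in the scoped solution, so [e'] keeps their values;
    their guards are given by [guards]. *)
Lemma scoped_sol_below k O G d e :
  (forall k', rk k' < rk k -> below_sig k') ->
  admissible G d -> guards_from O d -> depends_on_vars (dom G) O -> O e ->
  guards k e d -> cevalr S S e d -> pevalr R e (scoped_sol k d) ->
  exists2 e', {in [pred y | (y \notin binders d) || (y \in scope_vars k d)], e' =1 e} & S k e'.
Proof.
move=> lt; elim: d G O e => [p|c1 IH1 c2 IH2|x b p d IH] G O e ad gd dO Oe.
- move=> _ ce se; have [|e' E Se'] := sol_below lt ad gd dO Oe ce (k := k).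
    by move: se; rewrite /scoped_sol /= pevalr_scope_head.
  by exists e' => // y; rewrite !inE orbF => yb; apply: E.
- have [a1 a2] := admissible_and ad; have [g1 g2] := guards_from_and gd.
  rewrite scoped_sol_and [guards _ _ _]/= scope_vars_and => gk ce se; have [h1 h2] := ce.
  case: ifP gk se => k1; case: ifP => k2 gk se.
  + have [e' E Se'] := sol_below lt ad gd dO Oe ce se.
    by exists e' => // y; rewrite !inE orbF => yb; apply: E.
  + have [e' E Se'] := IH1 _ _ _ a1 g1 dO Oe gk h1 se.
    exists e' => // y; rewrite !inE mem_cat negb_or => yb; apply: E; rewrite inE.
    by case/orP: yb => [/andP[->]|->]; rewrite ?orbT.
  + have [e' E Se'] := IH2 _ _ _ a2 g2 dO Oe gk h2 se.
    exists e' => // y; rewrite !inE mem_cat negb_or => yb; apply: E; rewrite inE.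
    by case/orP: yb => [/andP[_ ->]|->]; rewrite ?orbT.
  + have [e' E Se'] := sol_below lt ad gd dO Oe ce se.
    by exists e' => // y; rewrite !inE orbF => yb; apply: E.
- rewrite scoped_sol_all scope_vars_all [guards _ _ _]/=; case: ifP => kp.
    move=> _ ce se; have [e' E Se'] := sol_below lt ad gd dO Oe ce se.
    by exists e' => // y; rewrite !inE orbF => yb; apply: E; rewrite inE.
  have [ad' Gx xd np] := admissible_all ad => -[be pe gk] h se.
  have Oe' : extend O x b p e by [].
  have pS : pevalr S e p.
    apply: (body_below ad gd dO) pe => // k' k'p.
    by apply: lt; have [_ [_ _ [ep _]]] := ad; apply: ep k'p (scoped_sol_heads se).
  have {}h : cevalr S S e d.
    by have := h (e x) be; rewrite update_id; apply.
  have [e' E Se'] := IH _ _ _ ad' (guards_from_all gd) (extend_depends ad dO) Oe' gk h se.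
  exists e' => // y yb; apply: E; move: yb; rewrite !inE negb_or.
  by case: (y =P x) => [->|_] //=; rewrite xd.
Qed.

Hypotheses (ca : admissible [::] c) (cS : forall e, cevalr S S e c).
Hypothesis fixR : forall k e, R k e = pevalr R e (scoped_sol k c).

(** Strong induction on the rank. [scoped_sol_below] gives [S k] at some [e'], and [S k] depends
    only on the parameters and the prefix of the scope of [k], where [e'] agrees with [e]. *)
Lemma R_below k : below_sig k.
Proof.
have [n] := ubnP (rk k); elim: n k => // n IH k; rewrite ltnS => kn e gk.
rewrite fixR => se.
have lt k' : rk k' < rk k -> below_sig k' by move=> k'k; apply: IH; apply: leq_trans k'k kn.
have gd : guards_from (fun _ => True) c by move=> k' e' _ _.
have dO : depends_on_vars (dom ([::] : tenv)) (fun _ : env => True) by [].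
have [e' E] := scoped_sol_below lt ca gd dO I gk (cS e) se.
rewrite /interp_of; case sk: (sig k) => [q|] //.
have [[nc uc bc _ _] [_ st ec]] := ca.
apply: (scoped_sol_scope_dep sk nc (scoped_sol_heads se) uc ec st) => y; rewrite inE /= => yD.
apply: E; rewrite inE; case/orP: yD => [ky|->]; last by rewrite orbT.
apply/orP; left; apply/negP => yc.
have [[_ _ _ _ cc] _] := ca.
have : lookup T y <> None.
  elim: (c) cc yc => //= [c1 IH1 c2 IH2 [cc1 cc2]|x b p d IHd [Tx _ cd]].
    by rewrite mem_cat => /orP[/(IH1 cc1)|/(IH2 cc2)].
  by rewrite inE => /orP[/eqP->|/(IHd cd)] //; rewrite Tx.
by rewrite (pT ky).
Qed.

(** Guards true under [R] are true under [S] by [R_below], so the heads they lead to hold under [S],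
    and still do when their variables are read as true. *)
Lemma plain_heads O G d e :
  admissible G d -> guards_from O d -> depends_on_vars (dom G) O -> O e ->
  cevalr S S e d -> cevalr R (fun _ _ => True) e d.
Proof.
elim: d G O e => [p|c1 IH1 c2 IH2|x b p d IH] G O e ad gd dO Oe.
- by have [[np _ _ _ _] _] := ad; apply: pevalr_mono.
- have [a1 a2] := admissible_and ad; have [g1 g2] := guards_from_and gd.
  by case=> /(IH1 _ _ _ a1 g1 dO Oe) ? /(IH2 _ _ _ a2 g2 dO Oe).
- have [ad' Gx xd np] := admissible_all ad => h v bv pv.
  have Oe' := extend_update dO Gx Oe bv pv.
  apply: (IH _ _ _ ad' (guards_from_all gd) (extend_depends ad dO) Oe').
  apply: h => //; apply: (body_below ad gd dO) pv => [k' _|]; first exact: R_below.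
  by case: Oe'.
Qed.

Lemma complete e : cevalr R (fun _ _ => True) e c.
Proof. by apply: (@plain_heads (fun _ => True) [::]). Qed.
End Completeness.

(** Already the first removal would require a cycle. *)
Lemma greedy_cut_acyclic c X : acyclic c -> greedy_cut c X -> X = set0.
Proof.
move=> ac [rX _]; have c0 : cuts set0 c.
  case=> s s0 cs; apply: ac; exists s => //; case: s cs {s0} => //= k s.
  by apply: sub_path => i j /and3P[].
by elim: rX => // Y k _ -> [].
Qed.

Lemma satisfiable_sat solve c Q ks :
  is_solve args solve -> nnf c -> well_typed args [::] c -> uniq (binders c) ->
  (forall k, uniq (map fst (args k))) ->
  (forall k x, x \in map fst (args k) -> x \notin binders c) ->
  all (@refinement L K) Q -> acyclic c -> elim_list c ks -> local_first c ks ->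
  satisfiable args c -> sat args solve ks c Q.
Proof.
move=> solveP nc ct uc ua /binders_params_apart pT Qr ac [X [gX uks ksX]] lf.
have {gX} X0 := greedy_cut_acyclic ac gX; rewrite {X}X0 in ksX.
case=> sig [_ /andP[_ st] sv]; have [rk rkP] := acyclic_rank ac.
have cc := nnf_clean nc uc.
have c't := elim_clean_typed ks ua pT cc ct.
(* Constantly true is the empty conjunction of qualifiers, hence available to [solve] for every
   [Q]. *)
pose s : assignment L K := fun _ => Some (PTrue L K).
have stot : total_typed s by move=> k; exists (PTrue L K).
have sQ : qualifier_assignment args Q s by move=> k; exists [::].
have sks k r : k \in ks -> s k = Some r -> well_typed_pred args (args k) r.
  by move=> _ [<-].
have sr k : exists2 q, s k = Some q & refinement q by exists (PTrue L K).
have sc't := cinst_total_typed stot c't.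
apply/(solveP _ _ (flatten_flat _) Qr); exists s; split=> // d dc; split.
- by move=> k p [<-].
- by rewrite /well_formed cinst_refinement // (cinst_total_typed stot (flatten_typed c't dc)).
- move: d dc; apply/flatten_valid => M e; apply/ceval_cinst.
  have -> : interp_of s = (fun _ _ => True) :> (K -> (var -> value M) -> Prop) by [].
  have kX k : k \in ks -> k \notin set0 by rewrite inE.
  have rc : ranked set0 rk c.
    apply/edges_ranked/dep_edges_in => k k' /rkP->; by rewrite !orbT.
  apply: (@pullback_heads_true M ks c s) => //.
  apply: (@complete M (bdecls c) (pullback ks c s) sig rk) => //.
  + split; split=> //; [exact: pullback_typed cc ct uks sks sc't|exact: dep_edges_in].
  + by move=> e'; apply/ceval_cinst/sv.
  + move=> k e'; apply: (@pullback_fixpoint M set0 rk) => //.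
    by rewrite ksX !inE.
Qed.
End Elimination.

Theorem theorem5p14 (L : logic) (K : finType) (args : K -> seq (decl (base L)))
    (solve : seq (constr L K) -> seq (predicate L K) -> bool)
    (c : constr L K) (Q : seq (predicate L K)) :
  is_solve args solve ->
  nnf c ->
  well_typed args [::] c ->
  (* naming convention: distinct bound variables, distinct parameters *)
  uniq (binders c) ->
  (forall k, uniq (map fst (args k))) ->
  (forall k x, x \in map fst (args k) -> x \notin binders c) ->
  all (@refinement L K) Q ->
  (forall ks, elim_list c ks -> sat args solve ks c Q -> satisfiable args c) /\
  (acyclic c -> forall ks, elim_list c ks -> local_first c ks ->
     (sat args solve ks c Q <-> satisfiable args c)).
Proof.
move=> solveP nc ct uc ua ab Qr; split=> [ks ksP|ac ks ksP lf].
  exact: sat_satisfiable.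
by split; [apply: sat_satisfiable|apply: satisfiable_sat].
Qed.
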